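(* Let $n\ge 1$. The iterated wreath product $\Theta_n$ embeds in the category $\mathbf{nCat}$ of small strict $n$-categories as the full subcategory spanned by the free $n$-categories $F_n(T_* )$ on $T_*$, where $T$ runs through the set of finite level-trees of height $\le n$ (the object of $\Theta_n$ corresponding to $T$ being sent to $F_n(T_* )$). In particular, $\Theta_n$ is dense in $\mathbf{nCat}$.
   Context: $\Delta$ is the category of ordinals $[m]=\{0<\dots<m\}$, $m\ge 0$, and order-preserving maps. For a small category $\mathcal A$, the wreath product $\Delta\wr\mathcal A$ has as objects the tuples $(A_1,\dots,A_m)$ ($m\ge 0$) of objects of $\mathcal A$; a morphism $(A_1,\dots,A_m)\to(B_1,\dots,B_l)$ is a tuple $(\phi;\phi_1,\dots,\phi_m)$ with $\phi:[m]\to[l]$ in $\Delta$ and $\phi_i=(\phi_i^k:A_i\to B_k)_{\phi(i-1)<k\le\phi(i)}$ a family of morphisms of $\mathcal A$; composition is induced by composition in $\Delta$ and $\mathcal A$ (the component of a composite $\psi\phi$ from $i$ to $l$ is $\psi_k^l\phi_i^k$ for the unique $k$ with $\phi(i-1)<k\le\phi(i)$, $\psi(k-1)<l\le\psi(k)$). $\Theta_0$ is the terminal category, $\Theta_1=\Delta\cong\Delta\wr\Theta_0$, $\Theta_n=\Delta\wr\Theta_{n-1}$. Objects of $\Theta_n$ are identified with finite planar rooted level-trees of height $\le n$: $(T_1,\dots,T_m)$ is the tree whose root has $m$ incoming edges (ordered left to right) with $T_i$ grafted on top of the $i$-th edge; the object of $\Theta_0$ and the empty tuple are the tree consisting of the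 root only, of height $0$. An $n$-graph is a graded set $(X_k)_{0\le k\le n}$ with source/target maps $s,t:X_k\rightrightarrows X_{k-1}$ such that $ss=st$ and $ts=tt$. Equivalently, for $n\geq 1$, it is a graph enriched in $(n-1)$-graphs, i.e. a set of objects $X_0$ with an $(n-1)$-graph $X(x,y)$ for each $x,y\in X_0$. Batanin's star-construction assigns to each level-tree $T$ of height $\le n$ an $n$-graph $T_*$, described recursively as follows: for $n=0$, $T_*$ is the one-point set; for $T=(S^1,\dots,S^m)$ of height $\le n$, $n\ge1$, $T_*$ has object set $\{0,1,\dots,m\}$, $T_*(i-1,i)=S^i_*$ for $1\le i\le m$ (as an $(n-1)$-graph), and all other $T_*(i,j)$ are empty. $F_n$ is the left adjoint of the forgetful functor from $\mathbf{nCat}$ to $n$-graphs. A small subcategory $\mathcal A$ of a category $\mathcal V$ is dense if the nerve functor $\mathcal V\to\mathbf{Sets}^{\mathcal A^{op}}$, $V\mapsto\mathcal V(-,V)|_{\mathcal A}$, is fully faithful. *)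

(* Defs.v *)
From mathcomp Require Import all_boot.
From Stdlib Require Import FunctionalExtensionality ProofIrrelevance.

Set Implicit Arguments.
Unset Strict Implicit.
Unset Printing Implicit Defensive.

Declare Scope cat_scope.
Delimit Scope cat_scope with cat.
Local Open Scope cat_scope.

Record category := Category {
  ob :> Type;
  hom : ob -> ob -> Type;
  idm : forall x, hom x x;
  comp : forall x y z, hom y z -> hom x y -> hom x z;
  comp1m : forall x y (f : hom x y), comp (idm y) f = f;
  compm1 : forall x y (f : hom x y), comp f (idm x) = f;
  compA : forall x y z t (h : hom z t) (g : hom y z) (f : hom x y),
    comp h (comp g f) = comp (comp h g) f
}.
Arguments hom {c} _ _.
Arguments idm {c} x.
Arguments comp {c x y z} _ _.
Notation "g ∘ f" := (comp g f) (at level 40, left associativity) : cat_scope.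

Record functor (C D : category) := Functor {
  fob :> C -> D;
  fmap : forall x y, hom x y -> hom (fob x) (fob y);
  fmap1 : forall x, fmap (idm x) = idm (fob x);
  fmapM : forall x y z (g : hom y z) (f : hom x y),
    fmap (g ∘ f) = fmap g ∘ fmap f
}.
Arguments fmap {C D} _ {x y} _.

Definition fully_faithful C D (F : functor C D) : Prop :=
  forall x y : C, bijective (@fmap C D F x y).

Record adjunction C D (F : functor C D) (U : functor D C) := Adjunction {
  adj_unit : forall x : C, hom x (U (F x));
  adj_unit_nat : forall (x y : C) (f : hom x y),
    fmap U (fmap F f) ∘ adj_unit x = adj_unit y ∘ f;
  adj_bij : forall (x : C) (y : D),
    bijective (fun g : hom (F x) y => fmap U g ∘ adj_unit x)
}.

Definition idF (C : category) : functor C C.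
Proof. by exists id (fun _ _ => id). Defined.

Record presheaf (A : category) := Presheaf {
  psob :> A -> Type;
  psmap : forall a b, hom a b -> psob b -> psob a;
  psmap1 : forall a u, psmap (idm a) u = u;
  psmapM : forall a b c (g : hom b c) (f : hom a b) u,
    psmap (g ∘ f) u = psmap f (psmap g u)
}.
Arguments psmap {A} p {a b} _ _.

Record psh_hom (A : category) (P Q : presheaf A) := PshHom {
  pshfun :> forall a, P a -> Q a;
  psh_nat : forall a b (f : hom a b) (u : P b),
    pshfun (psmap P f u) = psmap Q f (pshfun u)
}.

Lemma psh_hom_eq A (P Q : presheaf A) (s t : psh_hom P Q) :
  (forall a, s a =1 t a) -> s = t.
Proof.
case: s t => [s sn] [t tn] /= e.
have {}e : s = t.
  by apply: functional_extensionality_dep => a; exact: functional_extensionality (e a).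
by subst t; congr PshHom; apply: proof_irrelevance.
Qed.

Definition psh_id A (P : presheaf A) : psh_hom P P :=
  @PshHom A P P (fun _ u => u) (fun _ _ _ _ => erefl).

Definition psh_comp A (P Q R : presheaf A) (t : psh_hom Q R) (s : psh_hom P Q) :
  psh_hom P R.
Proof. by exists (fun a u => t a (s a u)) => a b f u; rewrite !psh_nat. Defined.

Section Nerve.
Variables (A V : category) (E : functor A V).

Definition nerve (X : V) : presheaf A.
Proof.
exists (fun a => hom (E a) X) (fun a b f u => u ∘ fmap E f).
- by move=> a u; rewrite fmap1 compm1.
- by move=> a b c g f u; rewrite fmapM compA.
Defined.

Definition nerve_map (X Y : V) (h : hom X Y) : psh_hom (nerve X) (nerve Y).
Proof. by exists (fun a u => h ∘ u) => a b f u /=; rewrite compA. Defined.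

Lemma nerve_map1 X : nerve_map (idm X) = psh_id (nerve X).
Proof. by apply: psh_hom_eq => a u /=; rewrite comp1m. Qed.

Lemma nerve_mapM X Y Z (g : hom Y Z) (f : hom X Y) :
  nerve_map (g ∘ f) = psh_comp (nerve_map g) (nerve_map f).
Proof. by apply: psh_hom_eq => a u /=; rewrite compA. Qed.

(* The nerve functor of E is fully faithful.  It is not phrased through
   [fully_faithful] because the presheaves on [A] form a category one universe
   above [V]. *)
Definition dense : Prop := forall X Y : V, bijective (@nerve_map X Y).

End Nerve.

Section Delta.

Record mono (m l : nat) := Mono {
  mono_fun :> 'I_m.+1 -> 'I_l.+1;
  mono_le : forall i j : 'I_m.+1, i <= j -> mono_fun i <= mono_fun j
}.

Lemma mono_eq m l (f g : mono m l) : f =1 g -> f = g.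
Proof.
case: f g => [f fm] [g gm] /= /functional_extensionality e.
by subst g; congr Mono; apply: proof_irrelevance.
Qed.

Definition Delta : category.
Proof.
exists nat mono (fun m => @Mono m m id (fun _ _ => id))
  (fun m l k (g : mono l k) (f : mono m l) =>
    @Mono m k (g \o f) (fun i j h => mono_le g (mono_le f h))).
- by move=> m l f; apply: mono_eq.
- by move=> m l f; apply: mono_eq.
- by move=> m l k p h g f; apply: mono_eq.
Defined.

(* The edges of the ordinal [m] are indexed from 0: [i : 'I_m] is the edge from
   [src i] = i to [tgt i] = i+1.  The edge k+1 of [l] satisfies
   phi(i) < k+1 <= phi(i+1) iff phi(i) <= k < phi(i+1). *)
Definition src m (i : 'I_m) : 'I_m.+1 := widen_ord (leqnSn m) i.
Definition tgt m (i : 'I_m) : 'I_m.+1 := lift ord0 i.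

Definition over m l (f : mono m l) (i : 'I_m) (k : 'I_l) : bool :=
  (f (src i) <= k) && (k < f (tgt i)).

Lemma over_uniq m l (f : mono m l) (i j : 'I_m) (k : 'I_l) :
  over f i k -> over f j k -> i = j.
Proof.
move=> /andP[i1 i2] /andP[j1 j2]; apply/val_inj.
case: (ltngtP i j) => // h.
- have hle : tgt i <= src j by [].
  by have := leq_trans (leq_trans i2 (mono_le f hle)) j1; rewrite ltnn.
- have hle : tgt j <= src i by [].
  by have := leq_trans (leq_trans j2 (mono_le f hle)) i1; rewrite ltnn.
Qed.

Lemma over_id m (i k : 'I_m) : over (@idm Delta m) i k -> i = k.
Proof.
case/andP => /= h1; rewrite /bump /= add1n ltnS => h2.
by apply/val_inj/eqP; rewrite eqn_leq; apply/andP; split.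
Qed.

Lemma over_idm m (i : 'I_m) : over (@idm Delta m) i i.
Proof. by rewrite /over /= /bump /= add1n leqnn ltnS leqnn. Qed.

Lemma over_comp m l p (f : @hom Delta m l) (g : @hom Delta l p) i k j :
  over f i k -> over g k j -> over (g ∘ f) i j.
Proof.
move=> /andP[i1 i2] /andP[j1 j2]; apply/andP; split => /=.
- exact: leq_trans (mono_le g (i1 : f (src i) <= src k)) j1.
- exact: leq_trans j2 (mono_le g (i2 : tgt k <= f (tgt i))).
Qed.

Lemma over_mid_ex m l p (f : @hom Delta m l) (g : @hom Delta l p) i j :
  over (g ∘ f) i j -> exists k, over f i k && over g k j.
Proof.
case/andP => /= h1 h2.
have ex : exists v : nat, (v <= l) && (j < g (inord v)).
  by exists (f (tgt i)); rewrite inord_val h2 -ltnS ltn_ord.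
case: (ex_minnP ex) => v /andP[vl jv] vmin.
have fv : f (src i) < v.
  rewrite ltnNge; apply/negP => vf.
  have hle : (inord v : 'I_l.+1) <= f (src i) by rewrite inordK ?ltnS.
  by have := leq_trans jv (leq_trans (mono_le g hle) h1); rewrite ltnn.
case: v vl jv vmin fv => [//|v] vl jv vmin fv.
exists (Ordinal vl); rewrite /over /= -ltnS fv /=.
have -> : tgt (Ordinal vl) = inord v.+1 by apply: val_inj; rewrite /= inordK ?ltnS.
rewrite jv andbT; apply/andP; split.
  by apply: vmin; rewrite inord_val h2 -ltnS ltn_ord.
rewrite leqNgt; apply/negP => h.
have e : src (Ordinal vl) = inord v by apply: val_inj; rewrite /= inordK // ltnW.
by have := vmin v; rewrite (ltnW vl) -e h ltnn => /(_ isT).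
Qed.

Definition over_mid m l p (f : @hom Delta m l) (g : @hom Delta l p) i j
    (h : over (g ∘ f) i j) : 'I_l := xchoose (over_mid_ex h).

Lemma over_midl m l p (f : @hom Delta m l) (g : @hom Delta l p) i j
  (h : over (g ∘ f) i j) : over f i (over_mid h).
Proof. by case/andP: (xchooseP (over_mid_ex h)). Qed.

Lemma over_midr m l p (f : @hom Delta m l) (g : @hom Delta l p) i j
  (h : over (g ∘ f) i j) : over g (over_mid h) j.
Proof. by case/andP: (xchooseP (over_mid_ex h)). Qed.

End Delta.

Record tuples (A : Type) := Tuple {
  len : nat;
  item :> 'I_len -> A
}.

Section Wreath.
Variable A : category.

Record wreath_hom (s t : tuples A) := WreathHom {
  wmap : @hom Delta (len s) (len t);
  wcpt : forall i k, over wmap i k -> hom (s i) (t k)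
}.
Arguments wcpt {s t} w {i k} _.

Lemma wreath_hom_eq s t (f g : wreath_hom s t) :
  wmap f =1 wmap g ->
  (forall i k hf hg, @wcpt s t f i k hf = @wcpt s t g i k hg) -> f = g.
Proof.
case: f g => [f fc] [g gc] /= e.
have {}e : f = g by apply: mono_eq.
subst g => ec; congr WreathHom.
apply: functional_extensionality_dep => i.
apply: functional_extensionality_dep => k.
by apply: functional_extensionality_dep => h.
Qed.

Definition wreath_id s : wreath_hom s s :=
  @WreathHom s s (@idm Delta (len s)) (fun i k h =>
    match over_id h in _ = k' return hom (s i) (s k') with
    | erefl => idm (s i)
    end).

(* The component of a composite from i to j goes through the unique edge k of the
   middle ordinal lying over i and below j. *)
Definition wreath_comp s t u (g : wreath_hom t u) (f : wreath_hom s t) :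
    wreath_hom s u :=
  @WreathHom s u (wmap g ∘ wmap f)
    (fun i j h => wcpt g (over_midr h) ∘ wcpt f (over_midl h)).

Lemma wreath_compE s t u (g : wreath_hom t u) (f : wreath_hom s t) i k j
    (hf : over (wmap f) i k) (hg : over (wmap g) k j)
    (h : over (wmap (wreath_comp g f)) i j) :
  wcpt (wreath_comp g f) h = wcpt g hg ∘ wcpt f hf.
Proof.
rewrite /=; move: (over_midr h) (over_midl h).
move: (over_mid h) => k' hr hl.
have ek : k' = k by apply: over_uniq hr hg.
by subst k'; congr (wcpt g _ ∘ wcpt f _); apply: bool_irrelevance.
Qed.

Lemma wreath_idE s i (h : over (wmap (wreath_id s)) i i) :
  wcpt (wreath_id s) h = idm (s i).
Proof.
rewrite /=; move: (over_id h) => e.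
by rewrite (proof_irrelevance _ e erefl).
Qed.

Lemma wreath_comp1m s t (f : wreath_hom s t) : wreath_comp (wreath_id t) f = f.
Proof.
apply: wreath_hom_eq => // i k hf hg.
by rewrite (wreath_compE (g := wreath_id t) hg (over_idm k)) wreath_idE comp1m.
Qed.

Lemma wreath_compm1 s t (f : wreath_hom s t) : wreath_comp f (wreath_id s) = f.
Proof.
apply: wreath_hom_eq => // i k hf hg.
by rewrite (wreath_compE (f := wreath_id s) (over_idm i) hg) wreath_idE compm1.
Qed.

Lemma wreath_compA s t u v (h : wreath_hom u v) (g : wreath_hom t u)
    (f : wreath_hom s t) :
  wreath_comp h (wreath_comp g f) = wreath_comp (wreath_comp h g) f.
Proof.
apply: wreath_hom_eq => // i l o1 o2.
pose k := over_mid o1; pose j := over_mid (over_midl o1).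
have oij : over (wmap f) i j := over_midl (over_midl o1).
have ojk : over (wmap g) j k := over_midr (over_midl o1).
have okl : over (wmap h) k l := over_midr o1.
rewrite (wreath_compE (f := wreath_comp g f) (over_comp oij ojk) okl).
rewrite (wreath_compE oij ojk).
rewrite (wreath_compE (g := wreath_comp h g) oij (over_comp ojk okl)).
by rewrite (wreath_compE ojk okl) compA.
Qed.

Definition wreath : category :=
  @Category (tuples A) wreath_hom wreath_id wreath_comp
    wreath_comp1m wreath_compm1 wreath_compA.

End Wreath.

Definition one_cat : category.
Proof.
exists unit (fun _ _ => unit) (fun _ => tt) (fun _ _ _ _ _ => tt).
- by move=> ? ? [].
- by move=> ? ? [].
- by [].
Defined.

(* An object of [Theta n] is a finite planar level-tree of height at most n,
   encoded as the tuple of the subtrees grafted on the edges of the root. *)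
Fixpoint Theta (n : nat) : category :=
  if n is m.+1 then wreath (Theta m) else one_cat.

Record cartcat := CartCat {
  ccat :> category;
  one : ccat;
  bang : forall x : ccat, hom x one;
  bang_uniq : forall (x : ccat) (f : hom x one), f = bang x;
  prd : ccat -> ccat -> ccat;
  pr1 : forall x y : ccat, hom (prd x y) x;
  pr2 : forall x y : ccat, hom (prd x y) y;
  pair : forall z x y : ccat, hom z x -> hom z y -> hom z (prd x y);
  pr1_pair : forall z x y (f : hom z x) (g : hom z y), pr1 x y ∘ pair f g = f;
  pr2_pair : forall z x y (f : hom z x) (g : hom z y), pr2 x y ∘ pair f g = g;
  pair_eta : forall z x y (h : hom z (prd x y)), pair (pr1 x y ∘ h) (pr2 x y ∘ h) = h
}.
Arguments one {c}.
Arguments bang {c} x.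
Arguments prd {c} _ _.
Arguments pr1 {c x y}.
Arguments pr2 {c x y}.
Arguments pair {c z x y} _ _.
Notation "⟨ f , g ⟩" := (pair f g) (format "⟨ f ,  g ⟩") : cat_scope.

Section CartTheory.
Variable V : cartcat.
Implicit Types x y z w : V.

Lemma pair_comp z x y w (f : hom z x) (g : hom z y) (h : hom w z) :
  ⟨f, g⟩ ∘ h = ⟨f ∘ h, g ∘ h⟩.
Proof. by rewrite -[LHS]pair_eta !compA pr1_pair pr2_pair. Qed.

Lemma bang_comp z w (h : hom w z) : bang z ∘ h = bang w.
Proof. exact: bang_uniq. Qed.

Lemma compAr x y z w (h : hom z w) (g : hom y z) (f : hom x y) :
  h ∘ g ∘ f = h ∘ (g ∘ f).
Proof. by rewrite compA. Qed.

Lemma pair_id x y : ⟨pr1, pr2⟩ = idm (prd x y).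
Proof. by rewrite -[RHS]pair_eta !compm1. Qed.

Lemma prd_ext z x y (f g : hom z (prd x y)) :
  pr1 ∘ f = pr1 ∘ g -> pr2 ∘ f = pr2 ∘ g -> f = g.
Proof. by move=> h1 h2; rewrite -(pair_eta f) h1 h2 pair_eta. Qed.

Definition cartE := (comp1m, compm1, compAr, bang_comp, pair_comp, pr1_pair, pr2_pair).

End CartTheory.

Definition Sets : cartcat.
Proof.
pose C := @Category Type (fun X Y => X -> Y) (fun X x => x) (fun X Y Z g f x => g (f x))
  (fun _ _ _ => erefl) (fun _ _ _ => erefl) (fun _ _ _ _ _ _ _ => erefl).
exists C unit (fun _ _ => tt) (fun X Y : Type => (X * Y)%type)
  (fun X Y => fst) (fun X Y => snd) (fun Z X Y f g z => (f z, g z)) => //.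
- by move=> X f; apply: functional_extensionality => x; case: (f x).
- by move=> Z X Y h; apply: functional_extensionality => z /=; case: (h z).
Defined.

Record ecat (V : cartcat) := ECat {
  eob :> Type;
  ehom : eob -> eob -> V;
  eid : forall x, hom one (ehom x x);
  ecomp : forall x y z, hom (prd (ehom y z) (ehom x y)) (ehom x z);
  ecomp1m : forall x y,
    ecomp x y y ∘ ⟨eid y ∘ bang (ehom x y), idm (ehom x y)⟩ = idm (ehom x y);
  ecompm1 : forall x y,
    ecomp x x y ∘ ⟨idm (ehom x y), eid x ∘ bang (ehom x y)⟩ = idm (ehom x y);
  ecompA : forall x y z t,
    ecomp x z t ∘ ⟨pr1, ecomp x y z ∘ pr2⟩ =
    ecomp x y t ∘ ⟨ecomp y z t ∘ ⟨pr1, pr1 ∘ pr2⟩, pr2 ∘ pr2⟩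
      :> hom (prd (ehom z t) (prd (ehom y z) (ehom x y))) (ehom x t)
}.
Arguments ehom {V e} _ _.
Arguments eid {V e} x.
Arguments ecomp {V e x y z}.

Record efunctor V (C D : ecat V) := EFunctor {
  efob :> C -> D;
  efmap : forall x y, hom (ehom x y) (ehom (efob x) (efob y));
  efmap1 : forall x, efmap x x ∘ eid x = eid (efob x);
  efmapM : forall x y z,
    efmap x z ∘ ecomp = ecomp ∘ ⟨efmap y z ∘ pr1, efmap x y ∘ pr2⟩
}.
Arguments efmap {V C D} _ {x y}.

Section Enriched.
Variable V : cartcat.
Implicit Types C D E : ecat V.

(* The laws of an enriched category and functor on generalized elements. *)
Section Elements.
Variables (C D : ecat V) (F : efunctor C D) (w : V).

Lemma ecomp1 (x y : C) (f : hom w (ehom x y)) : ecomp ∘ ⟨eid y ∘ bang w, f⟩ = f.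
Proof.
have := congr1 (fun u => u ∘ f) (ecomp1m x y).
by rewrite !cartE.
Qed.

Lemma ecomp2 (x y : C) (f : hom w (ehom x y)) : ecomp ∘ ⟨f, eid x ∘ bang w⟩ = f.
Proof.
have := congr1 (fun u => u ∘ f) (ecompm1 x y).
by rewrite !cartE.
Qed.

Lemma ecomp3 (x y z t : C) (h : hom w (ehom z t)) (g : hom w (ehom y z))
    (f : hom w (ehom x y)) :
  ecomp ∘ ⟨h, ecomp ∘ ⟨g, f⟩⟩ = ecomp ∘ ⟨ecomp ∘ ⟨h, g⟩, f⟩.
Proof.
have := congr1 (fun u => u ∘ ⟨h, ⟨g, f⟩⟩) (ecompA x y z t).
by rewrite !cartE.
Qed.

Lemma efmap2 (x y z : C) (g : hom w (ehom y z)) (f : hom w (ehom x y)) :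
  efmap F ∘ (ecomp ∘ ⟨g, f⟩) = ecomp ∘ ⟨efmap F ∘ g, efmap F ∘ f⟩.
Proof.
have := congr1 (fun u => u ∘ ⟨g, f⟩) (efmapM F x y z).
by rewrite !cartE.
Qed.

Lemma efmap0 (x : C) (u : hom w one) : efmap F ∘ (eid x ∘ u) = eid (F x) ∘ u.
Proof. by rewrite -efmap1 compA. Qed.

End Elements.

Lemma efunctor_eq C D (f : C -> D) f1 g1 a b a' b' :
  (forall x y, f1 x y = g1 x y) ->
  @EFunctor V C D f f1 a b = EFunctor (efmap := g1) a' b'.
Proof.
move=> e; have {}e : f1 = g1.
  by do 2 (apply: functional_extensionality_dep => ?); apply: e.
by subst g1; congr EFunctor; apply: proof_irrelevance.
Qed.

Definition efunctor_id C : efunctor C C.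
Proof.
exists id (fun x y => idm _) => [x|x y z]; first by rewrite comp1m.
by rewrite !comp1m pair_id compm1.
Defined.

Definition efunctor_comp C D E (G : efunctor D E) (F : efunctor C D) : efunctor C E.
Proof.
exists (fun x => G (F x)) (fun x y => efmap G ∘ efmap F) => [x|x y z].
  by rewrite -compA !efmap1.
by rewrite -compA efmapM efmap2 !compA.
Defined.

Definition ecat_category : category.
Proof.
exists (ecat V) (@efunctor V) efunctor_id efunctor_comp.
- by move=> C D [f f1 a b]; apply: efunctor_eq => x y /=; rewrite comp1m.
- by move=> C D [f f1 a b]; apply: efunctor_eq => x y /=; rewrite compm1.
- by move=> C D E G h g f; apply: efunctor_eq => x y /=; rewrite compA.
Defined.

Definition ecat_one : ecat V.
Proof.
exists unit (fun _ _ => one) (fun _ => idm _) (fun _ _ _ => bang _) => *;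
  by rewrite ?[RHS]bang_uniq ?[LHS]bang_uniq.
Defined.

Definition ecat_prd C D : ecat V.
Proof.
exists (C * D)%type
  (fun p q => prd (ehom p.1 q.1) (ehom p.2 q.2))
  (fun p => ⟨eid p.1, eid p.2⟩)
  (fun p q r => ⟨ecomp ∘ ⟨pr1 ∘ pr1, pr1 ∘ pr2⟩, ecomp ∘ ⟨pr2 ∘ pr1, pr2 ∘ pr2⟩⟩).
- by move=> p q; rewrite !cartE !ecomp1 pair_id.
- by move=> p q; rewrite !cartE !ecomp2 pair_id.
- by move=> p q r s; rewrite !cartE !ecomp3.
Defined.

Definition ecat_bang C : efunctor C ecat_one.
Proof.
exists (fun _ => tt) (fun _ _ => bang _) => *;
  by rewrite ?[RHS]bang_uniq ?[LHS]bang_uniq.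
Defined.

Definition ecat_pr1 C D : efunctor (ecat_prd C D) C.
Proof. by exists fst (fun p q => pr1) => *; rewrite !cartE. Defined.

Definition ecat_pr2 C D : efunctor (ecat_prd C D) D.
Proof. by exists snd (fun p q => pr2) => *; rewrite !cartE. Defined.

Definition ecat_pair E C D (F : efunctor E C) (G : efunctor E D) :
  efunctor E (ecat_prd C D).
Proof.
exists (fun z => (F z, G z)) (fun x y => ⟨efmap F, efmap G⟩) => *.
  by rewrite !cartE !efmap1.
by rewrite !cartE !efmapM.
Defined.

Definition Cat_enriched : cartcat.
Proof.
exists ecat_category ecat_one ecat_bang ecat_prd ecat_pr1 ecat_pr2 ecat_pair.
- move=> C [f f1 a b].
  have e : f = fun _ => tt by apply: functional_extensionality => x; case: (f x).
  by subst f; apply: efunctor_eq => x y; apply: bang_uniq.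
- by move=> E C D [f f1 a b] [g g1 a' b']; apply: efunctor_eq => x y /=; rewrite pr1_pair.
- by move=> E C D [f f1 a b] [g g1 a' b']; apply: efunctor_eq => x y /=; rewrite pr2_pair.
- move=> E C D [f f1 a b].
  have [g [h e]] : exists g h, f = fun z => (g z, h z).
    exists (fst \o f), (snd \o f); apply: functional_extensionality => z /=.
    by case: (f z).
  by subst f; apply: efunctor_eq => x y /=; rewrite pair_eta.
Defined.

End Enriched.

(* Strict (n+1)-categories are categories enriched in strict n-categories. *)
Fixpoint nCat (n : nat) : cartcat :=
  if n is m.+1 then Cat_enriched (nCat m) else Sets.

Record egraph (W : category) := EGraph {
  gob :> Type;
  ghom : gob -> gob -> W
}.
Arguments ghom {W e} _ _.

Record egraph_hom W (X Y : egraph W) := EGraphHom {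
  gfob :> X -> Y;
  gfmap : forall x y, hom (ghom x y) (ghom (gfob x) (gfob y))
}.
Arguments gfmap {W X Y} _ {x y}.

Lemma egraph_hom_eq W (X Y : egraph W) (f : X -> Y) f1 g1 :
  (forall x y, f1 x y = g1 x y) -> @EGraphHom W X Y f f1 = EGraphHom g1.
Proof.
move=> e; have -> // : f1 = g1.
by do 2 (apply: functional_extensionality_dep => ?); apply: e.
Qed.

Definition Graph_enriched (W : category) : category.
Proof.
exists (egraph W) (@egraph_hom W)
  (fun X => @EGraphHom W X X id (fun x y => idm _))
  (fun X Y Z (g : egraph_hom Y Z) (f : egraph_hom X Y) =>
    @EGraphHom W X Z (fun x => g (f x)) (fun x y => gfmap g ∘ gfmap f)).
- by move=> X Y [f f1]; apply: egraph_hom_eq => x y; rewrite comp1m.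
- by move=> X Y [f f1]; apply: egraph_hom_eq => x y; rewrite compm1.
- by move=> *; apply: egraph_hom_eq => x y; rewrite compA.
Defined.

(* An (n+1)-graph is a graph enriched in n-graphs. *)
Fixpoint nGraph (n : nat) : category :=
  if n is m.+1 then Graph_enriched (nGraph m) else Sets.

(* The underlying graph functor, applying [U] to the hom-objects. *)
Definition eforget (V : cartcat) (W : category) (U : functor V W) :
  functor (Cat_enriched V) (Graph_enriched W).
Proof.
exists (fun C : ecat V => @EGraph W C (fun x y => U (ehom x y)))
  (fun (C D : ecat V) (F : efunctor C D) =>
     @EGraphHom W (EGraph (fun x y => U (ehom x y))) (EGraph (fun x y => U (ehom x y)))
       F (fun x y => fmap U (efmap F))).
- by move=> C; apply: egraph_hom_eq => x y; rewrite fmap1.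
- by move=> *; apply: egraph_hom_eq => x y; rewrite fmapM.
Defined.

Fixpoint forget (n : nat) : functor (nCat n) (nGraph n) :=
  match n with
  | 0 => idF Sets
  | m.+1 => eforget (forget m)
  end.

Definition empty_graph (n : nat) : nGraph n :=
  match n with
  | 0 => void
  | m.+1 => @EGraph (nGraph m) void (fun x _ => of_void _ x)
  end.

(* Batanin's star-construction: the vertices are 0, ..., m and, the subtrees being
   indexed from 0, the subtree [k] is the hom-graph from k to k+1. *)
Fixpoint star (n : nat) : Theta n -> nGraph n :=
  match n return Theta n -> nGraph n with
  | 0 => fun _ => unit
  | m.+1 => fun T : tuples (Theta m) =>
      @EGraph (nGraph m) 'I_(len T).+1 (fun i j =>
        if (insub (val i) : option 'I_(len T)) is Some k
        then if val j == k.+1 then @star m (T k) else empty_graph m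
        else empty_graph m)
  end.

Record free_on C D (U : functor D C) (x : C) := FreeOn {
  fobj : D;
  funit : hom x (U fobj);
  fext : forall y : D, hom x (U y) -> hom fobj y;
  fextK : forall (y : D) (f : hom x (U y)), fmap U (fext f) ∘ funit = f;
  fext_uniq : forall (y : D) (g g' : hom fobj y),
    fmap U g ∘ funit = fmap U g' ∘ funit -> g = g'
}.
Arguments fext {C D U x} _ {y} _.

Section LeftAdjoint.
Variables (C D : category) (U : functor D C) (fr : forall x, free_on U x).

Definition left_adjoint : functor C D.
Proof.
exists (fun x => fobj (fr x)) (fun x y f => fext (fr x) (funit (fr y) ∘ f)).
- by move=> x; apply: fext_uniq; rewrite fextK fmap1 comp1m compm1.
- move=> x y z g f; apply: fext_uniq.
  by rewrite fextK fmapM -compA fextK !compA fextK.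
Defined.

Lemma left_adjointP : adjunction left_adjoint U.
Proof.
exists (fun x => funit (fr x)) => [x y f|x y]; first exact: fextK.
exists (@fext _ _ _ _ (fr x) y) => [g|f]; last exact: fextK.
by apply: fext_uniq; rewrite fextK.
Qed.

End LeftAdjoint.

(* Small coproducts, stable under products. *)
Record coprods (V : cartcat) := Coprods {
  csum : forall I : Type, (I -> V) -> V;
  cin : forall (I : Type) (A : I -> V) (i : I), hom (A i) (csum A);
  ccase : forall (I : Type) (A : I -> V) (z x : V),
    (forall i, hom (prd z (A i)) x) -> hom (prd z (csum A)) x;
  ccase_in : forall (I : Type) (A : I -> V) (z x : V)
    (f : forall i, hom (prd z (A i)) x) (i : I),
    ccase f ∘ ⟨pr1, cin A i ∘ pr2⟩ = f i;
  ccase_uniq : forall (I : Type) (A : I -> V) (z x : V) (h h' : hom (prd z (csum A)) x),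
    (forall i, h ∘ ⟨pr1, cin A i ∘ pr2⟩ = h' ∘ ⟨pr1, cin A i ∘ pr2⟩) -> h = h'
}.
Arguments csum {V} _ {I} _.
Arguments cin {V} _ {I A} i.
Arguments ccase {V} _ {I A z x} _.

Section CoprodTheory.
Variables (V : cartcat) (K : coprods V).

Lemma ccaseE I (A : I -> V) z x w (f : forall i, hom (prd z (A i)) x) i
    (h : hom w z) (a : hom w (A i)) :
  ccase K f ∘ ⟨h, cin K i ∘ a⟩ = f i ∘ ⟨h, a⟩.
Proof.
have := congr1 (fun u => u ∘ ⟨h, a⟩) (ccase_in K f i).
by rewrite !cartE.
Qed.

Lemma csum_extr I (A : I -> V) z x (h h' : hom (prd z (csum K A)) x) :
  (forall i w (a : hom w z) (b : hom w (A i)),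
    h ∘ ⟨a, cin K i ∘ b⟩ = h' ∘ ⟨a, cin K i ∘ b⟩) -> h = h'.
Proof. by move=> e; apply: (ccase_uniq (c := K)) => i; apply: e. Qed.

Lemma csum_extl I (A : I -> V) z x (h h' : hom (prd (csum K A) z) x) :
  (forall i w (a : hom w z) (b : hom w (A i)),
    h ∘ ⟨cin K i ∘ b, a⟩ = h' ∘ ⟨cin K i ∘ b, a⟩) -> h = h'.
Proof.
move=> e.
have {}e : h ∘ ⟨pr2, pr1⟩ = h' ∘ ⟨pr2, pr1⟩.
  by apply: csum_extr => i w a b; rewrite !cartE.
have := congr1 (fun u => u ∘ ⟨pr2, pr1⟩) e.
by rewrite !cartE pair_id !compm1.
Qed.

Lemma csum_ext I (A : I -> V) x (h h' : hom (csum K A) x) :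
  (forall i w (b : hom w (A i)), h ∘ (cin K i ∘ b) = h' ∘ (cin K i ∘ b)) -> h = h'.
Proof.
move=> e.
have {}e : h ∘ pr2 = h' ∘ pr2 :> hom (prd one _) _.
  by apply: csum_extr => i w a b; rewrite !cartE.
have := congr1 (fun u => u ∘ ⟨bang _, idm _⟩) e.
by rewrite !cartE.
Qed.

Lemma csum_ext2 I (A : I -> V) J (B : J -> V) x
    (h h' : hom (prd (csum K A) (csum K B)) x) :
  (forall i j w (a : hom w (A i)) (b : hom w (B j)),
    h ∘ ⟨cin K i ∘ a, cin K j ∘ b⟩ = h' ∘ ⟨cin K i ∘ a, cin K j ∘ b⟩) -> h = h'.
Proof.
move=> e; apply: csum_extr => j w a b.
have {}e : h ∘ ⟨pr1, cin K j ∘ pr2⟩ = h' ∘ ⟨pr1, cin K j ∘ pr2⟩.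
  by apply: csum_extl => i w' b' a'; rewrite !cartE.
have := congr1 (fun u => u ∘ ⟨a, b⟩) e.
by rewrite !cartE.
Qed.

Lemma csum_ext3 I (A : I -> V) J (B : J -> V) L (C : L -> V) x
    (h h' : hom (prd (csum K A) (prd (csum K B) (csum K C))) x) :
  (forall i j l w (a : hom w (A i)) (b : hom w (B j)) (c : hom w (C l)),
    h ∘ ⟨cin K i ∘ a, ⟨cin K j ∘ b, cin K l ∘ c⟩⟩ =
    h' ∘ ⟨cin K i ∘ a, ⟨cin K j ∘ b, cin K l ∘ c⟩⟩) -> h = h'.
Proof.
move=> e.
have {}e i : h ∘ ⟨cin K i ∘ pr1, pr2⟩ = h' ∘ ⟨cin K i ∘ pr1, pr2⟩.
  have {}e j : h ∘ ⟨cin K i ∘ (pr1 ∘ pr1), ⟨cin K j ∘ (pr2 ∘ pr1), pr2⟩⟩ =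
               h' ∘ ⟨cin K i ∘ (pr1 ∘ pr1), ⟨cin K j ∘ (pr2 ∘ pr1), pr2⟩⟩.
    by apply: csum_extr => l w a b; rewrite !cartE.
  have {}e : h ∘ ⟨cin K i ∘ (pr1 ∘ pr1), ⟨pr2, pr2 ∘ pr1⟩⟩ =
             h' ∘ ⟨cin K i ∘ (pr1 ∘ pr1), ⟨pr2, pr2 ∘ pr1⟩⟩.
    apply: csum_extr => j w a b.
    have := congr1 (fun u => u ∘ ⟨⟨pr1 ∘ a, b⟩, pr2 ∘ a⟩) (e j).
    by rewrite !cartE.
  have := congr1 (fun u => u ∘ ⟨⟨pr1, pr2 ∘ pr2⟩, pr1 ∘ pr2⟩) e.
  by rewrite !cartE !pair_eta.
apply: csum_extl => i w a b.
have := congr1 (fun u => u ∘ ⟨b, a⟩) (e i).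
by rewrite !cartE.
Qed.

Lemma csum_ext22 I (A : I -> V) J (B : J -> V) y z x
    (h h' : hom (prd (prd y (csum K A)) (prd z (csum K B))) x) :
  (forall i j w (c : hom w y) (d : hom w z) (a : hom w (A i)) (b : hom w (B j)),
    h ∘ ⟨⟨c, cin K i ∘ a⟩, ⟨d, cin K j ∘ b⟩⟩ =
    h' ∘ ⟨⟨c, cin K i ∘ a⟩, ⟨d, cin K j ∘ b⟩⟩) -> h = h'.
Proof.
move=> e.
have {}e i : h ∘ ⟨⟨pr1 ∘ pr1, cin K i ∘ (pr2 ∘ pr1)⟩, ⟨pr1 ∘ pr2, pr2 ∘ pr2⟩⟩ =
             h' ∘ ⟨⟨pr1 ∘ pr1, cin K i ∘ (pr2 ∘ pr1)⟩, ⟨pr1 ∘ pr2, pr2 ∘ pr2⟩⟩.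
  have {}e : h ∘ ⟨⟨pr1 ∘ pr1, cin K i ∘ (pr1 ∘ (pr2 ∘ pr1))⟩,
                  ⟨pr2 ∘ (pr2 ∘ pr1), pr2⟩⟩ =
             h' ∘ ⟨⟨pr1 ∘ pr1, cin K i ∘ (pr1 ∘ (pr2 ∘ pr1))⟩,
                  ⟨pr2 ∘ (pr2 ∘ pr1), pr2⟩⟩.
    by apply: csum_extr => j w a b; rewrite !cartE.
  have := congr1 (fun u => u ∘ ⟨⟨pr1 ∘ pr1, ⟨pr2 ∘ pr1, pr1 ∘ pr2⟩⟩, pr2 ∘ pr2⟩) e.
  by rewrite !cartE.
have {}e : h ∘ ⟨⟨pr1 ∘ pr1, pr2⟩, pr2 ∘ pr1⟩ = h' ∘ ⟨⟨pr1 ∘ pr1, pr2⟩, pr2 ∘ pr1⟩.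
  apply: csum_extr => i w a b.
  have := congr1 (fun u => u ∘ ⟨⟨pr1 ∘ a, b⟩, pr2 ∘ a⟩) (e i).
  by rewrite !cartE !pair_eta.
have := congr1 (fun u => u ∘ ⟨⟨pr1 ∘ pr1, pr2⟩, pr2 ∘ pr1⟩) e.
by rewrite !cartE pair_eta pair_id !compm1.
Qed.

Definition ccasel I (A : I -> V) z x (f : forall i, hom (prd (A i) z) x) :
  hom (prd (csum K A) z) x := locked (ccase K (fun i => f i ∘ ⟨pr2, pr1⟩) ∘ ⟨pr2, pr1⟩).

Lemma ccaselE I (A : I -> V) z x w (f : forall i, hom (prd (A i) z) x) i
    (h : hom w z) (a : hom w (A i)) :
  ccasel f ∘ ⟨cin K i ∘ a, h⟩ = f i ∘ ⟨a, h⟩.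
Proof. by rewrite /ccasel -lock !cartE ccaseE !cartE. Qed.

Definition ccase1 I (A : I -> V) x (f : forall i, hom (A i) x) :
  hom (csum K A) x := locked (ccase K (fun i => f i ∘ pr2) ∘ ⟨bang _, idm _⟩).

Lemma ccase1E I (A : I -> V) x w (f : forall i, hom (A i) x) i (a : hom w (A i)) :
  ccase1 f ∘ (cin K i ∘ a) = f i ∘ a.
Proof. by rewrite /ccase1 -lock !cartE ccaseE !cartE. Qed.

End CoprodTheory.

Definition Sets_coprods : coprods Sets.
Proof.
exists (fun I (A : I -> Type) => {i : I & A i})
  (fun I (A : I -> Type) i (a : A i) => existT A i a)
  (fun I (A : I -> Type) Z X (f : forall i, Z * A i -> X) p =>
     f (projT1 p.2) (p.1, projT2 p.2)).
- move=> I A Z X f i; apply: functional_extensionality => -[z a] //.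
- move=> I A Z X h h' e; apply: functional_extensionality => -[z [i a]].
  exact: (congr1 (fun u => u (z, a)) (e i)).
Defined.

Lemma efunctor_inj V (C D : ecat V) (f : C -> D) f1 g1 a b a' b' :
  @EFunctor V C D f f1 a b = @EFunctor V C D f g1 a' b' -> f1 = g1.
Proof.
pose T (f : C -> D) := forall x y, hom (ehom x y) (ehom (f x) (f y)).
have gen (F G : efunctor C D) : F = G -> forall e : efob F = efob G,
    eq_rect _ T (@efmap V C D F) _ e = @efmap V C D G.
  by move=> <- e; rewrite (proof_irrelevance _ e erefl).
by move=> e; apply: (gen _ _ e erefl).
Qed.

Section EnrichedCoprods.
Variables (V : cartcat) (K : coprods V).

Section Sum.
Variables (I : Type) (C : I -> ecat V).

Definition tr i j (e : i = j) (x : C i) : C j := eq_rect i (fun k => eob (C k)) x j e.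

Definition sum_hom (p q : {i : I & C i}) : V :=
  csum K (fun e : projT1 p = projT1 q => ehom (tr e (projT2 p)) (projT2 q)).

Definition sum_comp_at i j k (x : C i) (y : C j) (z : C k) (e' : j = k) (e : i = j) :
  hom (prd (ehom (tr e' y) z) (ehom (tr e x) y))
      (sum_hom (existT _ i x) (existT _ k z)).
Proof. by subst k j; exact: (cin K (erefl i) ∘ ecomp). Defined.

Definition sum_comp (p q r : {i : I & C i}) :
  hom (prd (sum_hom q r) (sum_hom p q)) (sum_hom p r) :=
  match p, q, r with
  | existT i x, existT j y, existT k z =>
    ccase K (fun e => ccasel K (fun e' => sum_comp_at x y z e' e))
  end.

Definition sum_in i (x y : C i) :
  hom (ehom x y) (sum_hom (existT _ i x) (existT _ i y)) := cin K (erefl i).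

Lemma sum_compE i (x y z : C i) w (g : hom w (ehom y z)) (f : hom w (ehom x y)) :
  sum_comp (existT _ i x) (existT _ i y) (existT _ i z) ∘
    ⟨sum_in y z ∘ g, sum_in x y ∘ f⟩ = sum_in x z ∘ (ecomp ∘ ⟨g, f⟩).
Proof.
have e1 := @ccaseE V K _ _ _ _ w (fun e : i = i =>
  ccasel K (fun e' : i = i => sum_comp_at x y z e' e)) erefl (sum_in y z ∘ g) f.
have e2 := @ccaselE V K _ _ _ _ w
  (fun e' : i = i => sum_comp_at x y z e' erefl) erefl f g.
apply: etrans e1 _; apply: etrans e2 _.
by rewrite /= compAr.
Qed.

Definition ecat_sum : ecat V.
Proof.
exists {i : I & C i} sum_hom (fun p => sum_in (projT2 p) (projT2 p) ∘ eid (projT2 p))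
  sum_comp.
- move=> [i x] [j y]; apply: (csum_ext (K := K)) => /= e w b; subst j.
  suff : sum_comp (existT _ i x) (existT _ i y) (existT _ i y) ∘
      ⟨sum_in y y ∘ (eid y ∘ bang w), sum_in x y ∘ b⟩ = sum_in x y ∘ b.
    by move=> h; rewrite !cartE; exact: h.
  by rewrite sum_compE ecomp1.
- move=> [i x] [j y]; apply: (csum_ext (K := K)) => /= e w b; subst j.
  suff : sum_comp (existT _ i x) (existT _ i x) (existT _ i y) ∘
      ⟨sum_in x y ∘ b, sum_in x x ∘ (eid x ∘ bang w)⟩ = sum_in x y ∘ b.
    by move=> h; rewrite !cartE; exact: h.
  by rewrite sum_compE ecomp2.
- move=> [i x] [j y] [k z] [l t]; apply: (csum_ext3 (K := K)) => /= e1 e2 e3 w a b c.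
  subst l k j.
  suff : sum_comp (existT _ i x) (existT _ i z) (existT _ i t) ∘
      ⟨sum_in z t ∘ a, sum_comp (existT _ i x) (existT _ i y) (existT _ i z) ∘
        ⟨sum_in y z ∘ b, sum_in x y ∘ c⟩⟩ =
    sum_comp (existT _ i x) (existT _ i y) (existT _ i t) ∘
      ⟨sum_comp (existT _ i y) (existT _ i z) (existT _ i t) ∘
        ⟨sum_in z t ∘ a, sum_in y z ∘ b⟩, sum_in x y ∘ c⟩.
    by move=> h; rewrite !cartE; exact: h.
  by rewrite !sum_compE ecomp3.
Defined.

Definition ecat_in i : efunctor (C i) ecat_sum.
Proof.
exists (fun x => existT (fun i => eob (C i)) i x) (fun x y => sum_in x y) => //.
by move=> x y z; rewrite [RHS]sum_compE pair_id compm1.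
Defined.

Variables (Z B : ecat V) (f : forall i, efunctor (ecat_prd Z (C i)) B).

Definition case_map i j (z z' : Z) (x : C i) (y : C j) (e : i = j) :
  hom (prd (ehom z z') (ehom (tr e x) y)) (ehom (f i (z, x)) (f j (z', y))).
Proof. by subst j; exact: (@efmap _ _ _ (f i) (z, x) (z', y)). Defined.

Definition case_hom i j (z z' : Z) (x : C i) (y : C j) :
  hom (prd (ehom z z') (sum_hom (existT _ i x) (existT _ j y)))
      (ehom (f i (z, x)) (f j (z', y))) :=
  ccase K (fun e => case_map z z' x y e).

Lemma case_homE i (z z' : Z) (x y : C i) w (a : hom w (ehom z z'))
    (b : hom w (ehom x y)) :
  case_hom z z' x y ∘ ⟨a, sum_in x y ∘ b⟩ =
  @efmap _ _ _ (f i) (z, x) (z', y) ∘ ⟨a, b⟩.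
Proof.
exact: (@ccaseE V K _ _ _ _ w (fun e : i = i => case_map z z' x y e) erefl a b).
Qed.

Definition ecat_case : efunctor (ecat_prd Z ecat_sum) B.
Proof.
exists (fun p => f (projT1 p.2) (p.1, projT2 p.2))
  (fun p q => case_hom p.1 q.1 (projT2 p.2) (projT2 q.2)).
- move=> [z [i x]]; apply: etrans (case_homE _ _) _.
  exact: (efmap1 (f i) (z, x)).
- move=> [z1 [i x]] [z2 [j y]] [z3 [k t]] /=.
  apply: (csum_ext22 (K := K)) => /= e' e w c d a b; subst k j.
  suff : case_hom z1 z3 x t ∘
      ⟨ecomp ∘ ⟨c, d⟩, sum_comp (existT _ i x) (existT _ i y) (existT _ i t) ∘
        ⟨sum_in y t ∘ a, sum_in x y ∘ b⟩⟩ =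
    ecomp ∘ ⟨case_hom z2 z3 y t ∘ ⟨c, sum_in y t ∘ a⟩,
             case_hom z1 z2 x y ∘ ⟨d, sum_in x y ∘ b⟩⟩.
    by move=> h; rewrite !cartE; exact: h.
  rewrite sum_compE !case_homE.
  have := @efmap2 _ _ _ (f i) w (z1, x) (z2, y) (z3, t) ⟨c, a⟩ ⟨d, b⟩.
  by rewrite /= !cartE.
Defined.

End Sum.

Definition Cat_enriched_coprods : coprods (Cat_enriched V).
Proof.
exists ecat_sum ecat_in ecat_case.
- move=> I C Z B f i.
  have -> : f i = f i ∘ ⟨pr1, pr2⟩ :> @hom (Cat_enriched V) _ _.
    by rewrite pair_id compm1.
  apply: efunctor_eq => -[z x] [z' x'].
  exact: (case_homE f pr1 pr2).
- move=> I C Z B [h h1 a b] [h' h1' a' b'] e.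
  have eh : h = h'.
    apply: functional_extensionality => -[z [i x]].
    exact: (congr1 (fun F : efunctor (ecat_prd Z (C i)) B => F (z, x)) (e i)).
  subst h'; apply: efunctor_eq => -[z [i x]] [z' [j y]].
  apply: (csum_extr (K := K)) => /= ee w c d; subst j.
  have /(congr1 (fun F => F (z, x) (z', y))) /= := efunctor_inj (e i).
  by move/(congr1 (fun u => u ∘ ⟨c, d⟩)); rewrite !cartE.
Defined.

End EnrichedCoprods.

Fixpoint nCat_coprods (n : nat) : coprods (nCat n) :=
  match n with
  | 0 => Sets_coprods
  | m.+1 => Cat_enriched_coprods (nCat_coprods m)
  end.

(* The free enriched category on an enriched graph: a hom-object is the sum, over
   all paths, of the product of the hom-objects along the path. *)
Section FreeEnriched.
Variables (V : cartcat) (K : coprods V) (X : egraph V).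

Inductive path : X -> X -> Type :=
| path_nil x : path x x
| path_cons x y z : path y z -> path x z.

Fixpoint path_prd x z (p : path x z) : V :=
  match p with
  | path_nil _ => one
  | path_cons x y _ q => prd (path_prd q) (ghom x y)
  end.

Definition free_hom x z : V := csum K (@path_prd x z).

Definition path_in x z (p : path x z) : hom (path_prd p) (free_hom x z) := cin K p.

Lemma free_ext x y v (h h' : hom (free_hom x y) v) :
  (forall (p : path x y) w (b : hom w (path_prd p)),
    h ∘ (path_in p ∘ b) = h' ∘ (path_in p ∘ b)) -> h = h'.
Proof. exact: csum_ext. Qed.

Lemma free_extr x y u v (h h' : hom (prd u (free_hom x y)) v) :
  (forall (p : path x y) w (a : hom w u) (b : hom w (path_prd p)),
    h ∘ ⟨a, path_in p ∘ b⟩ = h' ∘ ⟨a, path_in p ∘ b⟩) -> h = h'.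
Proof. exact: csum_extr. Qed.

Lemma free_extl x y u v (h h' : hom (prd (free_hom x y) u) v) :
  (forall (p : path x y) w (a : hom w u) (b : hom w (path_prd p)),
    h ∘ ⟨path_in p ∘ b, a⟩ = h' ∘ ⟨path_in p ∘ b, a⟩) -> h = h'.
Proof. exact: csum_extl. Qed.

Definition path_add x y z : hom (prd (free_hom y z) (ghom x y)) (free_hom x z) :=
  ccasel K (fun q : path y z => path_in (path_cons x q)).

Lemma path_addE x y z (q : path y z) w (g : hom w (path_prd q)) (a : hom w (ghom x y)) :
  path_add x y z ∘ ⟨path_in q ∘ g, a⟩ = path_in (path_cons x q) ∘ ⟨g, a⟩.
Proof. exact: (ccaselE K (fun q : path y z => path_in (path_cons x q)) a g). Qed.

Fixpoint path_act z x y (p : path x y) {struct p} :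
    hom (prd (free_hom y z) (path_prd p)) (free_hom x z) :=
  match p in path x y
    return hom (prd (free_hom y z) (path_prd p)) (free_hom x z) with
  | path_nil _ => pr1
  | path_cons x v y q =>
    path_add x v z ∘ ⟨path_act z q ∘ ⟨pr1, pr1 ∘ pr2⟩, pr2 ∘ pr2⟩
  end.

Definition free_comp x y z : hom (prd (free_hom y z) (free_hom x y)) (free_hom x z) :=
  ccase K (@path_act z x y).

Lemma free_compE x y z w (h : hom w (free_hom y z)) (p : path x y)
    (f : hom w (path_prd p)) :
  free_comp x y z ∘ ⟨h, path_in p ∘ f⟩ = path_act z p ∘ ⟨h, f⟩.
Proof. exact: (ccaseE K (@path_act z x y)). Qed.

Lemma free_comp_add x y z t w (h : hom w (free_hom z t)) (s : hom w (free_hom y z))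
    (a : hom w (ghom x y)) :
  free_comp x z t ∘ ⟨h, path_add x y z ∘ ⟨s, a⟩⟩ =
  path_add x y t ∘ ⟨free_comp y z t ∘ ⟨h, s⟩, a⟩.
Proof.
have e : free_comp x z t ∘ ⟨pr1 ∘ pr1, path_add x y z ∘ ⟨pr2, pr2 ∘ pr1⟩⟩ =
    path_add x y t ∘ ⟨free_comp y z t ∘ ⟨pr1 ∘ pr1, pr2⟩, pr2 ∘ pr1⟩.
  apply: free_extr => q w' c b.
  by rewrite !cartE path_addE !free_compE /= !cartE.
have := congr1 (fun u => u ∘ ⟨⟨h, a⟩, s⟩) e.
by rewrite !cartE.
Qed.

Lemma cin_cons x y z (q : path y z) w (f : hom w (path_prd (path_cons x q))) :
  path_in (path_cons x q) ∘ f =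
  path_add x y z ∘ ⟨path_in q ∘ (pr1 ∘ f), pr2 ∘ f⟩.
Proof. by rewrite path_addE pair_eta. Qed.

Definition ecat_free : ecat V.
Proof.
exists X free_hom (fun x => path_in (path_nil x)) free_comp.
- move=> x y; apply: free_ext => p w b.
  rewrite !cartE.
  elim: p w b => {x y} [x|x y z q IH] w b.
    by rewrite free_compE /= !cartE [b]bang_uniq.
  by rewrite cin_cons free_comp_add IH.
- move=> x y.
  apply: etrans (@free_compE x x y _ _ (path_nil x) (bang _)) _.
  by rewrite /= cartE.
- move=> x y z t.
  have e w (h : hom w (free_hom z t)) (g : hom w (free_hom y z)) (p : path x y)
      (f : hom w (path_prd p)) :
      free_comp x z t ∘ ⟨h, free_comp x y z ∘ ⟨g, path_in p ∘ f⟩⟩ =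
      free_comp x y t ∘ ⟨free_comp y z t ∘ ⟨h, g⟩, path_in p ∘ f⟩.
    elim: p w h g f => {x y} [x|x y v q IH] w h g f.
      by rewrite !free_compE /= !cartE.
    by rewrite cin_cons !free_comp_add IH.
  have {}e : free_comp x z t ∘ ⟨pr1 ∘ pr1, free_comp x y z ∘ ⟨pr2 ∘ pr1, pr2⟩⟩ =
      free_comp x y t ∘ ⟨free_comp y z t ∘ ⟨pr1 ∘ pr1, pr2 ∘ pr1⟩, pr2⟩.
    by apply: free_extr => p w b f; rewrite !cartE e.
  have := congr1 (fun u => u ∘ ⟨⟨pr1, pr1 ∘ pr2⟩, pr2 ∘ pr2⟩) e.
  by rewrite !cartE pair_eta.
Defined.

Definition free_edge x y : hom (ghom x y) (free_hom x y) :=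
  locked (path_in (path_cons x (path_nil y)) ∘ ⟨bang _, idm _⟩).

Lemma path_add_edge x y z w (s : hom w (free_hom y z)) (a : hom w (ghom x y)) :
  path_add x y z ∘ ⟨s, a⟩ = free_comp x y z ∘ ⟨s, free_edge x y ∘ a⟩.
Proof. by rewrite /free_edge -lock !cartE free_compE /= !cartE. Qed.

Section Extend.
Variables (D : ecat V) (f : X -> D) (f1 : forall x y, hom (ghom x y) (ehom (f x) (f y))).

Fixpoint path_eval x y (p : path x y) : hom (path_prd p) (ehom (f x) (f y)) :=
  match p in path x y return hom (path_prd p) (ehom (f x) (f y)) with
  | path_nil x => eid (f x)
  | path_cons x v y q => ecomp ∘ ⟨path_eval q ∘ pr1, f1 x v ∘ pr2⟩
  end.

Definition free_eval x y : hom (free_hom x y) (ehom (f x) (f y)) :=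
  ccase1 K (@path_eval x y).

Lemma free_eval_in x y (p : path x y) w (a : hom w (path_prd p)) :
  free_eval x y ∘ (path_in p ∘ a) = path_eval p ∘ a.
Proof. exact: (ccase1E K (@path_eval x y)). Qed.

Lemma free_eval_add x y z w (s : hom w (free_hom y z)) (a : hom w (ghom x y)) :
  free_eval x z ∘ (path_add x y z ∘ ⟨s, a⟩) =
  ecomp ∘ ⟨free_eval y z ∘ s, f1 x y ∘ a⟩.
Proof.
have e : free_eval x z ∘ path_add x y z =
    ecomp ∘ ⟨free_eval y z ∘ pr1, f1 x y ∘ pr2⟩.
  apply: free_extl => q w' c b.
  by rewrite !cartE path_addE !free_eval_in /= !cartE.
have := congr1 (fun u => u ∘ ⟨s, a⟩) e.
by rewrite !cartE.
Qed.

Definition ecat_free_ext : efunctor ecat_free D.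
Proof.
exists f free_eval.
- by move=> x; have := @free_eval_in x x (path_nil x) _ (idm one); rewrite /= !compm1.
- move=> x y z.
  apply: free_extr => p w h g; rewrite !cartE.
  elim: p w h g => {x y} [x|x y v q IH] w h g.
    by rewrite free_compE free_eval_in /= !cartE [g]bang_uniq ecomp2.
  by rewrite cin_cons free_comp_add !free_eval_add IH ecomp3.
Defined.

Lemma free_eval_edge x y : free_eval x y ∘ free_edge x y = f1 x y.
Proof.
rewrite /free_edge -lock.
apply: etrans (@free_eval_in x y (path_cons x (path_nil y)) _ ⟨bang _, idm _⟩) _.
by rewrite /= !cartE ecomp1.
Qed.

End Extend.

Lemma ecat_free_uniq (D : ecat V) (f : X -> D) g1 g1' a b a' b' :
  (forall x y, g1 x y ∘ free_edge x y = g1' x y ∘ free_edge x y) ->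
  @EFunctor V ecat_free D f g1 a b = @EFunctor V ecat_free D f g1' a' b'.
Proof.
move=> e; set G := (X in X = _); set G' := (X in _ = X).
apply: efunctor_eq => x y; apply: free_ext => p w h.
elim: p w h => {x y} [x|x y z q IH] w h.
  by rewrite !compA (efmap1 G x) (efmap1 G' x).
have eG := @efmap2 _ _ _ G w x y z (path_in q ∘ (pr1 ∘ h)) (free_edge x y ∘ (pr2 ∘ h)).
have eG' := @efmap2 _ _ _ G' w x y z (path_in q ∘ (pr1 ∘ h)) (free_edge x y ∘ (pr2 ∘ h)).
rewrite cin_cons path_add_edge [LHS]eG [RHS]eG' /=.
by rewrite IH [g1 x y ∘ _]compA e !compA.
Qed.

End FreeEnriched.

Lemma egraph_hom_inj W (X Y : egraph W) (f : X -> Y) f1 g1 :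
  @EGraphHom W X Y f f1 = EGraphHom g1 -> f1 = g1.
Proof.
pose T (f : X -> Y) := forall x y, hom (ghom x y) (ghom (f x) (f y)).
have gen (F G : egraph_hom X Y) : F = G -> forall e : gfob F = gfob G,
    eq_rect _ T (@gfmap W X Y F) _ e = @gfmap W X Y G.
  by move=> <- e; rewrite (proof_irrelevance _ e erefl).
by move=> e; apply: (gen _ _ e erefl).
Qed.

Section FreeStep.
Variables (V : cartcat) (W : category) (U : functor V W) (K : coprods V).
Variable fr : forall x : W, free_on U x.

Definition eforget_free (X : egraph W) : free_on (eforget U) X.
Proof.
pose FX := EGraph (fun x y : X => fobj (fr (ghom x y))).
exists (ecat_free K FX : Cat_enriched V)
  (@EGraphHom W X (eforget U (ecat_free K FX : Cat_enriched V)) id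
     (fun x y => fmap U (@free_edge V K FX x y) ∘ funit (fr (ghom x y))))
  (fun (D : ecat V) (f : @egraph_hom W X (EGraph (fun x y => U (ehom x y)))) =>
     @ecat_free_ext V K FX D f (fun x y : X => fext (fr (ghom x y)) (gfmap f))).
- move=> D [f f1]; apply: egraph_hom_eq => x y /=.
  rewrite compA -fmapM; apply: etrans (fextK _ (f1 x y)).
  by congr (fmap U _ ∘ _);
  exact: (@free_eval_edge V K FX D f (fun x y : X => fext (fr (ghom x y)) (f1 x y))).
- move=> D [g g1 a b] [g' g1' a' b'] e.
  have eg : g = g' := congr1 (@gfob _ _ _) e.
  subst g'; apply: ecat_free_uniq => x y; apply: fext_uniq.
  have /(congr1 (fun F => F x y)) := egraph_hom_inj e.
  by rewrite !fmapM !compA.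
Defined.

End FreeStep.

Definition Sets_free (X : Sets) : free_on (idF Sets) X.
Proof. by exists X (idm X) (fun Y f => f). Defined.

Fixpoint nCat_free (n : nat) : forall X : nGraph n, free_on (forget n) X :=
  match n return forall X : nGraph n, free_on (forget n) X with
  | 0 => Sets_free
  | m.+1 => eforget_free (nCat_coprods m) (@nCat_free m)
  end.

(* F_n; the next lemma shows that it is left adjoint to [forget n]. *)
Definition free (n : nat) : functor (nGraph n) (nCat n) := left_adjoint (@nCat_free n).

Lemma free_adjunction (n : nat) : adjunction (free n) (forget n).
Proof. exact: left_adjointP. Qed.

(* Main.v *)
From mathcomp Require Import all_boot.
From Stdlib Require Import FunctionalExtensionality ProofIrrelevance.
From Stdlib Require Import IndefiniteDescription.
Require Import Defs.

(** The theorem is proved by induction on [n], for a stronger statement that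
also starts at [n = 0]: the embedding [E0] of [A := Theta n] into
[V := nCat n] is fully faithful and dense, and no [E0 a] has a morphism to an
empty object.

An object [T] of [wreath A] with [m] entries is sent to the free [V]-category
on the linear graph [0 -> 1 -> ... -> m] whose [k]-th edge carries the object
[E0 (T k)]; this is the free [n.+1]-category on the star of [T].  The heart of
the matter is the shape of its hom-objects: the one from [i] to [j] is the
product of the [E0 (T k)] over the edges [k] between [i] and [j] if [i <= j],
and it is empty if [j < i].  In terms of generalized elements this is
[lin_hom_chain] (existence), [lin_hom_ext] (uniqueness) and [lin_descent]
(emptiness).  The projection to the [k]-th factor is not built by hand: it is
the action on hom-objects of the functor that collapses everything before the
edge [k] to a point and everything after it to another one, with values in the
suspension of [E0 (T k)].

A functor out of a free [V]-category is given by the images of the vertices and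
of the edges.  By the shape of the hom-objects, a functor between two free
linear categories is therefore a map [phi] of vertices, together with, for each
edge [i] of the source, a family of morphisms from [E0 (S i)] to the [E0 (T k)]
with [k] between the images of the ends of [i].  The map [phi] is monotone
because no [E0 (S i)] has a morphism to an empty object, and since [E0] is fully
faithful these data are exactly the morphisms of [wreath A] ([wreath_map_inj],
[wreath_map_surj]).

For density, let [t] be a natural transformation between the nerves of two
[V]-categories [X] and [Y].  The trees with no edge, with one edge and with two
edges suffice to reconstruct a functor from [X] to [Y]: the first gives its
action on objects, the second gives a natural transformation between the nerves
of the hom-objects, hence morphisms of [V] because [E0] is dense, and the third,
which represents composable pairs, gives compatibility with composition.  All
the verifications come from one identity, [nerve_arrow_at], which expresses the
naturality of [t] along the functors that represent an arrow.

Finally [E] is injective on objects because it is fully faithful and isomorphic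
objects of [Theta n] are equal: a monotone bijection of ordinals is an
identity ([Theta_skeletal], [ff_skeletal_inj]). *)

Set Implicit Arguments.
Unset Strict Implicit.
Unset Printing Implicit Defensive.
Local Open Scope cat_scope.

(** * Bijections, casts, skeletal categories and strict initial objects *)

(** Composition of generalized elements of hom-objects: for a fixed [w], the
sets [hom w (ehom x y)] form an ordinary category under it, and enriched
functors act functorially. *)
Notation "g ⊙ f" := (ecomp ∘ ⟨g, f⟩) (at level 40, left associativity) : cat_scope.

Lemma inj_surj_bij T U (f : T -> U) :
  injective f -> (forall y, exists x, f x = y) -> bijective f.
Proof.
move=> fI fS.
pose g y := proj1_sig (constructive_indefinite_description _ (fS y)).
have gK : cancel g f.
  by move=> y; exact: proj2_sig (constructive_indefinite_description _ (fS y)).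
by exists g => // x; apply: fI; rewrite gK.
Qed.

Section Categories.
Variable C : category.
Implicit Types x y w o : C.

Definition cast x y (e : x = y) : hom x y := eq_rect x (hom x) (idm x) y e.

Lemma castK x y (e : x = y) : cast (esym e) ∘ cast e = idm x.
Proof. by subst y; rewrite comp1m. Qed.

Lemma castVK x y (e : x = y) : cast e ∘ cast (esym e) = idm y.
Proof. by subst y; rewrite comp1m. Qed.

(** Strictness is recorded by its consequence: two parallel morphisms out of an
object that maps to [o] are equal. *)
Record strict_initial o := StrictInitial {
  from_initial : forall x, hom o x;
  over_initial : forall w x (u : hom w o) (f g : hom w x), f = g
}.

Definition skeletal : Prop :=
  forall x y (f : hom x y) (g : hom y x), g ∘ f = idm x -> f ∘ g = idm y -> x = y.

End Categories.

Section Initial.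
Variables (V : cartcat) (K : coprods V).

Definition zero : V := csum K (of_void V).

(** Stability of the empty coproduct under products: [w] is a retract of
[prd w zero] as soon as it maps to [zero], and nothing distinguishes two
morphisms out of that product. *)
Lemma zero_strict : strict_initial zero.
Proof.
split=> [x|w x u f g]; first exact: (@ccase1 V K void _ x (fun v => match v with end)).
have e : f ∘ pr1 = g ∘ pr1 :> hom (prd w zero) x by apply: ccase_uniq.
have := congr1 (fun v => v ∘ ⟨idm w, u⟩) e.
by rewrite !cartE.
Qed.

End Initial.

(** * Arrows of an enriched category with free endpoints *)

Section Arrows.
Variable V : cartcat.
Implicit Types C D : ecat V.

(** Arrows carry their endpoints, so that images under functors whose actions on
objects are only propositionally equal can be compared without transport. *)
Definition arrow C (w : V) := {p : C * C & hom w (ehom p.1 p.2)}.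

Definition Arr C w (x y : C) (u : hom w (ehom x y)) : arrow C w :=
  existT (fun p : C * C => hom w (ehom p.1 p.2)) (x, y) u.

Lemma Arr_inj C w (x y : C) : injective (@Arr C w x y).
Proof. by move=> u v; exact: inj_pair2. Qed.

Definition amap C D (F : efunctor C D) w (s : arrow C w) : arrow D w :=
  Arr (efmap F ∘ projT2 s).

Lemma amap_comp C D E (G : efunctor D E) (F : efunctor C D) w (s : arrow C w) :
  amap (efunctor_comp G F) s = amap G (amap F s).
Proof. by rewrite /amap /= -compA. Qed.

(** The endpoints on the two sides need not agree syntactically; this is how
compositions are compared across different presentations of the vertices. *)
Lemma Arr_comp_eq C w (x y z x' y' z' : C) (g : hom w (ehom y z))
    (f : hom w (ehom x y)) (g' : hom w (ehom y' z')) (f' : hom w (ehom x' y')) :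
  Arr g = Arr g' -> Arr f = Arr f' -> Arr (g ⊙ f) = Arr (g' ⊙ f').
Proof.
move=> eg ef.
have [ey ez] : y = y' /\ z = z'.
  by have := congr1 (fun s => projT1 s) eg => /= -[].
have ex : x = x' by have := congr1 (fun s => projT1 s) ef => /= -[].
by subst x' y' z'; rewrite (Arr_inj eg) (Arr_inj ef).
Qed.

Lemma efunctor_ext C D (F G : efunctor C D) : F =1 G ->
  (forall x y, Arr (@efmap V C D F x y) = Arr (@efmap V C D G x y)) -> F = G.
Proof.
case: F G => [f f1 a b] [g g1 a' b'] /= /functional_extensionality e.
by subst g => e; apply: efunctor_eq => x y; apply: Arr_inj (e x y).
Qed.

End Arrows.

(** * Consecutive vertices of an ordinal *)

Section Edges.
Variables (n : nat) (P : 'I_n.+1 -> 'I_n.+1 -> Type).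
Variable at_edge : forall k : 'I_n, P (src k) (tgt k).
Variable off_edge : forall i j, (forall k, i = src k -> j <> tgt k) -> P i j.

Lemma src_inj : injective (@src n).
Proof. by move=> k l /(congr1 val) /= e; apply: val_inj. Qed.

(** A pair of vertices either consists of the two ends of an edge or does not;
data indexed by pairs of vertices are defined by this case distinction. *)
Inductive edge_view (i j : 'I_n.+1) : Type :=
| OnEdge k of i = src k & j = tgt k
| OffEdge of forall k, i = src k -> j <> tgt k.

Lemma edge_viewP i j : edge_view i j.
Proof.
case: (pickP (fun k => (i == src k) && (j == tgt k))) => [k|no].
  by case/andP=> /eqP ei /eqP ej; exact: OnEdge ei ej.
by apply: OffEdge => k ei ej; have := no k; rewrite ei ej !eqxx.
Qed.

Definition edge_rect i j : P i j.
Proof.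
case: (edge_viewP i j) => [k ei ej|no]; last exact: off_edge.
by rewrite ei ej; exact: at_edge.
Defined.

Lemma edge_rectE k : edge_rect (src k) (tgt k) = at_edge k.
Proof.
rewrite /edge_rect; case: edge_viewP => [l ei ej|no]; last by case: (no k).
have e := src_inj ei; subst l.
by rewrite (eq_irrelevance ei erefl) (eq_irrelevance ej erefl).
Qed.

End Edges.

(** * The suspension of an object *)

Section Suspension.
Variables (V : cartcat) (K : coprods V) (B : V).

(** The suspension of [B] has two objects, [false] before [true], and [B] as its
only non-trivial hom-object; booleans make the vertex map of a collapse a
comparison. *)
Definition susp_hom (a b : bool) : V :=
  match a, b with
  | false, true => B
  | true, false => zero K
  | _, _ => one
  end.

Definition susp_id a : hom one (susp_hom a a) :=
  if a as a return hom one (susp_hom a a) then idm one else idm one.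

Definition susp_comp a b c : hom (prd (susp_hom b c) (susp_hom a b)) (susp_hom a c) :=
  match a, b, c return hom (prd (susp_hom b c) (susp_hom a b)) (susp_hom a c) with
  | false, false, true => pr1
  | false, true, true => pr2
  | true, true, false => pr1
  | true, false, false => pr2
  | false, false, false | false, true, false
  | true, true, true | true, false, true => bang _
  end.

Definition susp : ecat V.
Proof.
exists bool susp_hom susp_id susp_comp.
- by move=> [] [] /=; rewrite ?cartE // [RHS]bang_uniq ?[LHS]bang_uniq.
- by move=> [] [] /=; rewrite ?cartE // [RHS]bang_uniq ?[LHS]bang_uniq.
(* If one of the three arrows runs backwards, the source of the law maps to the
   empty object. *)
- have z1 w x (f g : hom (prd (zero K) w) x) : f = g.
    exact: over_initial (zero_strict K) _ _ pr1 f g.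
  have z2 w v x (f g : hom (prd w (prd (zero K) v)) x) : f = g.
    exact: over_initial (zero_strict K) _ _ (pr1 ∘ pr2) f g.
  have z3 w v x (f g : hom (prd w (prd v (zero K))) x) : f = g.
    exact: over_initial (zero_strict K) _ _ (pr2 ∘ pr2) f g.
  move=> [] [] [] [] /=; rewrite ?cartE //;
    solve [exact: z1 | exact: z2 | exact: z3 | by rewrite [RHS]bang_uniq ?[LHS]bang_uniq].
Defined.

(** A generalized arrow between two comparable objects: it is only in the hom from
[false] to [true] that there is something to choose. *)
Definition susp_in w a b (ab : a ==> b) (h : a = false -> b = true -> hom w B) :
    hom w (@ehom V susp a b) :=
  match a, b return a ==> b -> (a = false -> b = true -> hom w B) ->
    hom w (susp_hom a b) with
  | false, true => fun _ h => h erefl erefl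
  | true, false => fun ab _ => match notF ab with end
  | false, false | true, true => fun _ _ => bang w
  end ab h.

Definition susp_out a b (ha : a = false) (hb : b = true) : hom (@ehom V susp a b) B.
Proof. by rewrite ha hb; exact: idm. Defined.

Lemma susp_outK w a b ab h (ha : a = false) (hb : b = true) :
  susp_out ha hb ∘ @susp_in w a b ab h = h ha hb.
Proof.
by subst a b; rewrite /susp_out /= comp1m.
Qed.

Lemma susp_out_l w a b c (ha : a = false) (hb : b = true) (hc : c = true)
    (g : hom w (@ehom V susp b c)) (f : hom w (@ehom V susp a b)) :
  susp_out ha hc ∘ (g ⊙ f) = susp_out ha hb ∘ f.
Proof.
by subst a b c; rewrite /susp_out /= !comp1m pr2_pair.
Qed.

Lemma susp_out_r w a b c (ha : a = false) (hb : b = false) (hc : c = true)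
    (g : hom w (@ehom V susp b c)) (f : hom w (@ehom V susp a b)) :
  susp_out ha hc ∘ (g ⊙ f) = susp_out hb hc ∘ g.
Proof.
by subst a b c; rewrite /susp_out /= !comp1m pr1_pair.
Qed.

End Suspension.
Arguments susp_out {V K B a b}.

(** * Free enriched categories on linear graphs *)

(** Off the edges the graph is only required to be empty up to isomorphism, since
the empty objects of interest are the free categories on empty graphs. *)
Record linear_graph (V : cartcat) n (B : 'I_n -> V) := LinearGraph {
  lhom : 'I_n.+1 -> 'I_n.+1 -> V;
  lhom_edge : forall k, lhom (src k) (tgt k) = B k;
  lhom_else : forall i j, (forall k, i = src k -> j <> tgt k) ->
    strict_initial (lhom i j)
}.

Section Linear.
Variables (V : cartcat) (K : coprods V) (n : nat) (B : 'I_n -> V).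
Variable G : linear_graph B.
Implicit Types (w : V) (x y z i j : 'I_n.+1) (k l : 'I_n).

Let X : egraph V := EGraph (lhom G).

(** [lin] is the free category, with laws that are separate lemmas so that
unfolding it stays cheap; [linE] makes the identification. *)
Lemma lin_comp1m (x y : X) : free_comp K x y y ∘
    ⟨path_in K (path_nil y) ∘ bang (free_hom K x y), idm (free_hom K x y)⟩ =
  idm (free_hom K x y).
Proof. exact: (@ecomp1m V (ecat_free K X)). Qed.

Lemma lin_compm1 (x y : X) : free_comp K x x y ∘
    ⟨idm (free_hom K x y), path_in K (path_nil x) ∘ bang (free_hom K x y)⟩ =
  idm (free_hom K x y).
Proof. exact: (@ecompm1 V (ecat_free K X)). Qed.

Lemma lin_compA (x y z t : X) :
  free_comp K x z t ∘ ⟨pr1, free_comp K x y z ∘ pr2⟩ =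
  free_comp K x y t ∘ ⟨free_comp K y z t ∘ ⟨pr1, pr1 ∘ pr2⟩, pr2 ∘ pr2⟩.
Proof. exact: (@ecompA V (ecat_free K X)). Qed.

Definition lin : ecat V :=
  @ECat V 'I_n.+1 (@free_hom V K X) (fun x => path_in K (@path_nil V X x))
    (@free_comp V K X) lin_comp1m lin_compm1 lin_compA.

Lemma linE : lin = ecat_free K X.
Proof. by congr ECat; exact: proof_irrelevance. Qed.

(** Locked, as is [proj] below, to keep associativity rewriting from unfolding it. *)
Definition edge k : hom (B k) (@ehom V lin (src k) (tgt k)) :=
  locked (@free_edge V K (EGraph (lhom G)) (src k) (tgt k) ∘ cast (esym (lhom_edge G k))).

Section Extend.
Variables (D : ecat V) (f : 'I_n.+1 -> D).
Variable f1 : forall k, hom (B k) (ehom (f (src k)) (f (tgt k))).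

Let f_edge : forall x y : X, hom (ghom x y) (ehom (f x) (f y)) :=
  edge_rect (P := fun i j => hom (lhom G i j) (ehom (f i) (f j)))
    (fun k => f1 k ∘ cast (lhom_edge G k))
    (fun i j no => from_initial (lhom_else G no) _).

Lemma lin_ext1 (x : X) : free_eval K f_edge x x ∘ path_in K (path_nil x) = eid (f x).
Proof. exact: (efmap1 (ecat_free_ext K f_edge)). Qed.

Lemma lin_extM (x y z : X) : free_eval K f_edge x z ∘ free_comp K x y z =
  ecomp ∘ ⟨free_eval K f_edge y z ∘ pr1, free_eval K f_edge x y ∘ pr2⟩.
Proof. exact: (efmapM (ecat_free_ext K f_edge)). Qed.

Definition lin_ext : efunctor lin D :=
  @EFunctor V lin D f (@free_eval V K X D f f_edge) lin_ext1 lin_extM.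

Lemma lin_extE k : @efmap V lin D lin_ext _ _ ∘ edge k = f1 k.
Proof.
rewrite /edge -lock compA free_eval_edge /f_edge edge_rectE.
by rewrite -compA castVK compm1.
Qed.

End Extend.

(** A functor is determined by its values on vertices and edges; the other
hom-objects of the graph are empty and carry no information. *)
Lemma lin_functor_ext (D : ecat V) (F F' : efunctor lin D) : F =1 F' ->
  (forall k, Arr (efmap F ∘ edge k) = Arr (efmap F' ∘ edge k)) -> F = F'.
Proof.
case: F F' => [f f1 a b] [g g1 a' b'] /= /functional_extensionality e.
subst g => e; apply: efunctor_eq => x y.
rewrite (efunctor_inj (@ecat_free_uniq V K X D f f1 g1 a b a' b' _)) // => {}x {}y.
case: (edge_viewP x y) => [k ex ey|no]; last first.
  exact: over_initial (lhom_else G no) _ _ (idm _) _ _.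
subst x y; have := congr1 (fun u => u ∘ cast (lhom_edge G k)) (Arr_inj (e k)).
by rewrite /edge -!lock !compAr castK !compm1.
Qed.

Lemma collapse_mono (k j : 'I_n) : (k < src j) ==> (k < tgt j).
Proof. by apply/implyP => /= h; rewrite ltnW. Qed.

(** The only edge with one end on each side of the collapse is [k] itself. *)
Lemma collapse_edge (k j : 'I_n) : (k < src j) = false -> (k < tgt j) = true -> j = k.
Proof.
move=> /= h1 h2; apply: val_inj; apply/eqP; rewrite eqn_leq.
by rewrite leqNgt h1 -ltnS h2.
Qed.

(** Vertices up to the source of [k] go to [false], those from its target on go
to [true], so that [k] becomes the only edge that survives. *)
Definition collapse k : efunctor lin (susp K (B k)) :=
  lin_ext (D := susp K (B k)) (f := fun i => k < i)
    (fun l => susp_in K (collapse_mono k l)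
       (fun h1 h2 => cast (congr1 B (collapse_edge h1 h2)))).

(** The edge [k], from [k] to [k+1], lies between the vertices [i] and [j]; with
the images of the ends of an edge as bounds this is [over]. *)
Definition seg (i k j : nat) : bool := (i <= k) && (k < j).

Lemma seg_false i k j : seg i k j -> (k < i) = false.
Proof. by case/andP => h _; rewrite ltnNge h. Qed.

Lemma seg_true i k j : seg i k j -> (k < j) = true.
Proof. by case/andP. Qed.

Definition proj (i j : 'I_n.+1) (k : 'I_n) (h : seg i k j) : hom (@ehom V lin i j) (B k) :=
  locked (susp_out (seg_false h) (seg_true h) ∘ @efmap V lin _ (collapse k) i j).
Arguments proj {i j k} h.

Lemma proj_edge k (h : seg (src k) k (tgt k)) : proj h ∘ edge k = idm _.
Proof.
rewrite /proj -!lock -compA lin_extE susp_outK.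
by rewrite (proof_irrelevance _ (congr1 B _) erefl).
Qed.

Section Elements.
Variable w : V.

Lemma proj_l x y z k (hz : seg x k z) (hy : seg x k y)
    (g : hom w (@ehom V lin y z)) (f : hom w (@ehom V lin x y)) :
  proj hz ∘ (g ⊙ f) = proj hy ∘ f.
Proof.
rewrite /proj -!lock -!compA (efmap2 (collapse k)).
rewrite (susp_out_l _ (seg_true hy)).
by rewrite (eq_irrelevance (seg_false hz) (seg_false hy)).
Qed.

Lemma proj_r x y z k (hz : seg x k z) (hy : seg y k z)
    (g : hom w (@ehom V lin y z)) (f : hom w (@ehom V lin x y)) :
  proj hz ∘ (g ⊙ f) = proj hy ∘ g.
Proof.
rewrite /proj -!lock -!compA (efmap2 (collapse k)).
rewrite (susp_out_r (seg_false hz) (seg_false hy)).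
by rewrite (eq_irrelevance (seg_true hz) (seg_true hy)).
Qed.

(** The collapse of the edge above [j] sends an arrow from [i] to [j] to an arrow
from [true] to [false]. *)
Lemma lin_descent i j (c : hom w (@ehom V lin i j)) : j < i -> hom w (zero K).
Proof.
move=> ji; have jn : j < n by rewrite -ltnS (leq_ltn_trans _ (ltn_ord i)).
have := @efmap V lin _ (collapse (Ordinal jn)) i j ∘ c.
by rewrite /= ji ltnn.
Qed.

Lemma lin_descent_eq i j (c : hom w (@ehom V lin i j)) (v : V) (f g : hom w v) :
  j < i -> f = g.
Proof.
by move=> /(lin_descent c) u; exact: over_initial (zero_strict K) _ _ u f g.
Qed.

End Elements.

Notation path := (@path V X).

Lemma path_in_cons x y z (q : path y z) w (e : hom w (path_prd (@path_cons V X x y z q))) :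
  path_in K (@path_cons V X x y z q) ∘ e =
  (path_in K q ∘ (pr1 ∘ e) : hom w (@ehom V lin y z)) ⊙ (@free_edge V K X x y ∘ (pr2 ∘ e)).
Proof. by rewrite cin_cons path_add_edge. Qed.

(** The first step of a non-trivial closed path is either not an edge, or an edge
followed by a path that runs backwards; in both cases the product along the path
is empty. *)
Lemma path_loop i j (p : path i j) w (e : hom w (path_prd p)) : i = j ->
  @Arr V lin w i j (path_in K p ∘ e) = @Arr V lin w i i (@eid V lin i ∘ bang w).
Proof.
case: p e => [x|x y z q] e /= xz; first by rewrite [e]bang_uniq.
subst z; congr Arr; case: (edge_viewP x y) => [k ex ey|no].
  apply: lin_descent_eq (path_in K q ∘ (pr1 ∘ e)) _ _ _ _.
  by rewrite ex ey.
exact: over_initial (lhom_else G no) _ _ (pr2 ∘ e) _ _.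
Qed.

(** A path that starts at [src k] and does not end there starts with the edge [k],
unless the product along it is empty, which is the first alternative. *)
Lemma path_step i j (p : path i j) w (e : hom w (path_prd p)) k : i = src k -> i < j ->
  (forall (v : V) (f g : hom w v), f = g) \/
  exists (q : path (tgt k) j) (c : hom w (path_prd q)) (a : hom w (B k)),
    @Arr V lin w i j (path_in K p ∘ e) =
    @Arr V lin w (src k) j ((path_in K q ∘ c : hom w (@ehom V lin _ _)) ⊙ (edge k ∘ a)).
Proof.
case: p e => [x|x y z q] e xk xz; first by rewrite ltnn in xz.
case: (edge_viewP x y) => [l ex ey|no]; last first.
  by left => v f g; exact: over_initial (lhom_else G no) _ _ (pr2 ∘ e) _ _.
right; subst x y; have := src_inj ex => e'; subst l.
exists q, (pr1 ∘ e), (cast (lhom_edge G k) ∘ (pr2 ∘ e)).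
rewrite path_in_cons /edge -lock; congr Arr; congr (_ ∘ ⟨_, _⟩).
by rewrite !compA -(compA _ (cast _) (cast _)) castK compm1.
Qed.

(** The operation [C] multiplies a family of elements of the labels between [i]
and [j], in order.  The third property is what makes the elements of a
hom-object unique: as the coproduct of the products along all paths, it is
tested on elements that come from a single path, and on those [C] undoes the
projections.  The three properties are proved together because the step
from [d] to [d.+1] uses all of them at the vertex after [i]. *)
Lemma lin_chain_ex (d : nat) (i j : 'I_n.+1) : j = i + d :> nat ->
  exists C : forall w, (forall k, seg i k j -> hom w (B k)) -> hom w (@ehom V lin i j),
  [/\ forall w w' b (u : hom w' w), C w b ∘ u = C w' (fun k h => b k h ∘ u),
      forall w b k h, proj h ∘ C w b = b k h
    & forall (p : path i j) w (e : hom w (path_prd p)),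
        C w (fun k h => proj h ∘ (path_in K p ∘ e)) = path_in K p ∘ e].
Proof.
elim: d i j => [|d IH] i j.
  rewrite addn0 => /val_inj ji; subst j.
  exists (fun w _ => @eid V lin i ∘ bang w); split.
  - by move=> *; rewrite !cartE.
  - by move=> w b k h; have := h; rewrite /seg ltnNge andbN.
  by move=> p w e; apply: Arr_inj; rewrite path_loop.
move=> ji.
have [k ik] : exists k, i = src k.
  have ki : i < n by rewrite -ltnS (leq_trans _ (ltn_ord j)) // ji addnS !ltnS leq_addr.
  by exists (Ordinal ki); apply: val_inj.
subst i.
have [C' [C'n C'p C'i]] := IH (tgt k) j (etrans ji (addnS _ _)).
have hk : seg (src k) k j by rewrite /seg /= leqnn ji addnS ltnS leq_addr.
have up l : seg (tgt k) l j -> seg (src k) l j.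
  by case/andP => h1 h2; rewrite /seg h2 andbT; exact: ltnW.
have he : seg (src k) k (tgt k) by rewrite /seg /= leqnn ltnSn.
exists (fun w b => C' w (fun l h => b l (up l h)) ⊙ (edge k ∘ b k hk)); split.
- by move=> w w' b u; rewrite !cartE C'n.
- move=> w b l h; case: (eqVneq l k) => [e|ne].
    subst l; rewrite (proj_l h he) compA proj_edge comp1m.
    by congr b; exact: bool_irrelevance.
  have h' : seg (tgt k) l j.
    by case/andP: (h) => h1 h2; rewrite /seg h2 andbT /= ltn_neqAle eq_sym ne.
  by rewrite (proj_r h h') C'p; congr b; exact: bool_irrelevance.
move=> p w e.
have kj : src k < j by rewrite ji addnS ltnS leq_addr.
case: (path_step e erefl kj) => [all_eq|[q [c [a pe]]]]; first exact: all_eq.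
rewrite (Arr_inj pe) (proj_l hk he) (compA _ (edge k)) proj_edge comp1m.
congr (_ ∘ ⟨_, _⟩); rewrite -[RHS]C'i; congr (C' w).
do 2 apply: functional_extensionality_dep => ?.
exact: proj_r.
Qed.

Variable w : V.

(** By the chain operation [C] for projections: it sends the projections
themselves to the identity, so each [c] is [C] of its projections. *)
Lemma lin_hom_ext i j (c c' : hom w (@ehom V lin i j)) :
  (forall k (h : seg i k j), proj h ∘ c = proj h ∘ c') -> c = c'.
Proof.
move=> e; case: (ltnP j i) => [ji|ij]; first exact: lin_descent_eq c _ _ _ ji.
have [C [Cn _ Ci]] := lin_chain_ex (esym (subnKC ij)).
have C1 : C _ (fun k h => proj h) = idm _.
  apply: free_ext => p u b.
  by rewrite (Cn _ _ _ (path_in K p ∘ b)) Ci comp1m.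
rewrite -[c]comp1m -[c']comp1m -C1 !Cn; congr (C w).
by do 2 apply: functional_extensionality_dep => ?.
Qed.

Lemma lin_hom_chain i j (b : forall k, seg i k j -> hom w (B k)) : i <= j ->
  exists c : hom w (@ehom V lin i j), forall k h, proj h ∘ c = b k h.
Proof.
move=> ij; have [C [_ Cp _]] := lin_chain_ex (esym (subnKC ij)).
by exists (C w b) => k h; exact: Cp.
Qed.

(** [c1] and [c2] are assembled from the projections of [c] before and after the
edge [k], so that the composite has the same projections as [c]. *)
Lemma lin_split i j k (h : seg i k j) (c : hom w (@ehom V lin i j)) :
  exists (c2 : hom w (@ehom V lin (tgt k) j)) (c1 : hom w (@ehom V lin i (src k))),
    c = c2 ⊙ ((edge k ∘ (proj h ∘ c)) ⊙ c1).
Proof.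
case/andP: (h) => ik kj.
have up l : seg (tgt k) l j -> seg i l j.
  by case/andP => h1 h2; rewrite /seg h2 andbT (leq_trans ik) // ltnW.
have dn l : seg i l (src k) -> seg i l j.
  by case/andP => h1 h2; rewrite /seg h1 (ltn_trans h2).
have [c2 c2p] := @lin_hom_chain (tgt k) j (fun l h => proj (up l h) ∘ c) kj.
have [c1 c1p] := @lin_hom_chain i (src k) (fun l h => proj (dn l h) ∘ c) ik.
exists c2, c1; apply: lin_hom_ext => l hl.
case/andP: (hl) => il lj.
have it : seg i k (tgt k) by rewrite /seg ik /= ltnSn.
have he : seg (src k) k (tgt k) by rewrite /seg /= leqnn ltnSn.
case: (ltngtP l k) => lk.
- have h1 : seg i l (tgt k) by rewrite /seg il /= ltnW.
  have h2 : seg i l (src k) by rewrite /seg il.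
  by rewrite (proj_l hl h1) (proj_l h1 h2) c1p; congr (proj _ ∘ _); exact: bool_irrelevance.
- have h1 : seg (tgt k) l j by rewrite /seg lj andbT.
  by rewrite (proj_r hl h1) c2p; congr (proj _ ∘ _); exact: bool_irrelevance.
- have := val_inj lk => e; subst l.
  rewrite (proj_l hl it) (proj_r it he) (compA _ (edge k)) proj_edge comp1m.
  by congr (proj _ ∘ _); exact: bool_irrelevance.
Qed.

End Linear.

Arguments edge {V} K {n B} G k.
Arguments proj {V K n B G i j k} h.
Arguments lin_ext {V} K {n B} G {D} f f1.

(** * The functor from a wreath product to enriched categories *)

Section Wreath.
Variables (V : cartcat) (K : coprods V) (A : category) (E0 : functor A V).
Variable G : forall T : tuples A, linear_graph (fun k => E0 (T k)).
Implicit Types S T U : tuples A.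

Definition wreath_ob T : ecat V := lin K (G T).
Notation L := wreath_ob.

(** The edge [i] goes to the composite, over the edges [k] between the images of
its ends, of the components of [f] at [i] and [k]. *)
Lemma edge_image_ex S T (f : wreath_hom S T) (i : 'I_(len S)) :
  exists c : hom (E0 (S i)) (@ehom V (L T) (wmap f (src i)) (wmap f (tgt i))),
    forall k (h : over (wmap f) i k), proj h ∘ c = fmap E0 (wcpt h).
Proof. by apply: lin_hom_chain; apply: mono_le => /=; apply: leqnSn. Qed.

Definition edge_image S T (f : wreath_hom S T) i :=
  proj1_sig (constructive_indefinite_description _ (edge_image_ex f i)).

Lemma proj_edge_image S T (f : wreath_hom S T) i k (h : over (wmap f) i k) :
  proj h ∘ edge_image f i = fmap E0 (wcpt h).
Proof. exact: (proj2_sig (constructive_indefinite_description _ (edge_image_ex f i))). Qed.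

Definition wreath_map S T (f : wreath_hom S T) : efunctor (L S) (L T) :=
  lin_ext K (G S) (D := L T) (wmap f) (edge_image f).

Lemma wreath_map_edge S T (f : wreath_hom S T) i :
  @efmap V _ _ (wreath_map f) (src i) (tgt i) ∘ edge K (G S) i = edge_image f i.
Proof. exact: lin_extE. Qed.

(** An arrow from [i] to [j] is a composite through the edge [k]; when [l] lies
between the images of the ends of [k], the other two factors do not contribute
to the [l]-th projection of the image. *)
Lemma proj_functor S T (F : efunctor (L S) (L T)) (i j : 'I_(len S).+1) (k : 'I_(len S))
    (l : 'I_(len T)) (hk : seg i k j) (hl : seg (F i) l (F j)) (h : seg (F (src k)) l (F (tgt k))) :
  proj hl ∘ @efmap V _ _ F i j = proj h ∘ (efmap F ∘ edge K (G S) k) ∘ proj hk.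
Proof.
have [c2 [c1 e]] := @lin_split V K _ _ (G S) _ i j k hk (idm _).
have h1 : seg (F i) l (F (tgt k)) by case/andP: hl => a _; case/andP: h => _ b; apply/andP.
rewrite -[LHS]compm1 [X in _ ∘ X]e -!compA.
rewrite (efmap2 F) (proj_l hl h1) (efmap2 F) (proj_r h1 h).
by rewrite compm1 !compA.
Qed.

Lemma wreath_map_id T : wreath_map (wreath_id T) = efunctor_id (L T).
Proof.
apply: lin_functor_ext => // k; congr Arr; rewrite wreath_map_edge comp1m.
apply: lin_hom_ext => l h; rewrite proj_edge_image.
have e := over_id h; subst l.
by rewrite wreath_idE fmap1 proj_edge.
Qed.

(** On an edge [i], both sides are determined by their projections; the [l]-th one
factors through the unique [k] over [i] and below [l], as composition in the
wreath product prescribes. *)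
Lemma wreath_map_comp S T U (g : wreath_hom T U) (f : wreath_hom S T) :
  wreath_map (wreath_comp g f) = efunctor_comp (wreath_map g) (wreath_map f).
Proof.
apply: lin_functor_ext => // i; congr Arr; rewrite wreath_map_edge.
apply: lin_hom_ext => l h; rewrite proj_edge_image.
have := over_midl h; have := over_midr h; move: (over_mid h) => k hr hl.
rewrite (wreath_compE hl hr) fmapM -!compA wreath_map_edge.
rewrite (compA (proj h)).
rewrite (@proj_functor _ _ (wreath_map g) _ _ k l hl h hr).
by rewrite wreath_map_edge proj_edge_image -compA proj_edge_image.
Qed.

Definition wreath_embedding : functor (wreath A) (Cat_enriched V) :=
  @Functor (wreath A) (Cat_enriched V) L wreath_map wreath_map_id wreath_map_comp.

Section FullyFaithful.
Hypothesis E0ff : fully_faithful E0.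
Hypothesis E0ne : forall a, hom (E0 a) (zero K) -> False.

Definition efunctor_component S T (F : efunctor (L S) (L T)) (i : 'I_(len S))
    (k : 'I_(len T)) (h : seg (F (src i)) k (F (tgt i))) : hom (E0 (S i)) (E0 (T k)) :=
  proj h ∘ (efmap F ∘ edge K (G S) i).

Lemma wreath_map_inj S T : injective (@wreath_map S T).
Proof.
move=> f g e; apply: wreath_hom_eq => [|i k hf hg].
  by move=> i; exact: (congr1 (fun F : efunctor (L S) (L T) => F i) e).
apply: (bij_inj (E0ff _ _)); rewrite -!proj_edge_image -!wreath_map_edge.
suff gen (F F' : efunctor (L S) (L T)) h h' : F = F' ->
    @efunctor_component S T F i k h = @efunctor_component S T F' i k h'.
  exact: gen e.
by move=> eF; subst F'; congr (proj _ ∘ _); exact: bool_irrelevance.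
Qed.

(** Each edge of the source carries an element over [E0 (S i)], and its image
forbids the vertices to go backwards, for it would lie over an empty object. *)
Lemma efunctor_mono S T (F : efunctor (L S) (L T)) (i j : 'I_(len S).+1) :
  i <= j -> (F i : 'I_(len T).+1) <= (F j : 'I_(len T).+1).
Proof.
move=> ij; have [d] := ubnP (j - i).
elim: d => // d IH in i ij *; move=> hd.
move: ij; rewrite leq_eqVlt => /orP[/eqP/val_inj-> //|ij].
have ki : i < len S by rewrite -ltnS (leq_ltn_trans ij).
have ei : i = src (Ordinal ki) by apply: val_inj.
apply: (@leq_trans (F (tgt (Ordinal ki)) : 'I_(len T).+1)).
  rewrite {1}ei leqNgt; apply/negP => back; apply: (@E0ne (S (Ordinal ki))).
  exact: lin_descent (efmap F ∘ edge K (G S) (Ordinal ki)) back.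
apply: IH => //.
by rewrite /= /bump add1n -ltnS subnSK.
Qed.

Lemma wreath_map_surj S T (F : efunctor (L S) (L T)) : exists f, wreath_map f = F.
Proof.
pose phi : @hom Delta (len S) (len T) :=
  @Mono (len S) (len T) F (@efunctor_mono S T F).
have pre i k (h : over phi i k) : exists a, fmap E0 a = efunctor_component h.
  by have [b _ bK] := E0ff (S i) (T k); exists (b (efunctor_component h)); exact: bK.
pose c i k h := proj1_sig (constructive_indefinite_description _ (pre i k h)).
have cE i k h : fmap E0 (c i k h) = efunctor_component h.
  exact: proj2_sig (constructive_indefinite_description _ (pre i k h)).
exists (@WreathHom A S T phi c).
apply: lin_functor_ext => // i; congr Arr; rewrite wreath_map_edge.
by apply: lin_hom_ext => k h; rewrite proj_edge_image cE.
Qed.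

Lemma wreath_embedding_ff : fully_faithful wreath_embedding.
Proof. by move=> S T; exact: inj_surj_bij (@wreath_map_inj S T) (@wreath_map_surj S T). Qed.

End FullyFaithful.
End Wreath.

(** * Density *)

Section Density.
Variables (V : cartcat) (K : coprods V) (A : category) (E0 : functor A V).
Variable G : forall T : tuples A, linear_graph (fun k => E0 (T k)).
Notation L := (wreath_ob K G).

(** The trees with no edge, with one edge and with two edges: the functors out of
the corresponding free categories are the objects, the arrows and the
composable pairs of arrows over [E0 a]. *)
Definition vertices : tuples A := @Tuple A 0 (fun k => match notF (ltn_ord k) with end).
Definition arrows a : tuples A := @Tuple A 1 (fun _ => a).
Definition triangles a : tuples A := @Tuple A 2 (fun _ => a).

Definition edge_arrow T k : arrow (L T) (E0 (T k)) := Arr (edge K (G T) k).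

Section Cells.
Variable X : ecat V.

Definition of_vertex (x : X) : efunctor (L vertices) X.
Proof.
apply: (lin_ext K (G vertices) (fun _ => x)).
by case=> [m lt]; have := notF lt.
Defined.

Definition of_arrow a (s : arrow X (E0 a)) : efunctor (L (arrows a)) X.
Proof.
apply: (lin_ext K (G (arrows a)) (D := X)
  (fun i => if val i is 0 then (projT1 s).1 else (projT1 s).2)).
by case=> [[|m] lt]; [exact: projT2 s | have := notF lt].
Defined.

Lemma of_arrow_edge a (s : arrow X (E0 a)) :
  amap (of_arrow s) (@edge_arrow (arrows a) ord0) = s.
Proof. by rewrite /amap lin_extE; case: s => [[x y] u]. Qed.

Lemma functor_vertices (F F' : efunctor (L vertices) X) : F ord0 = F' ord0 -> F = F'.
Proof.
move=> e; apply: lin_functor_ext => [i|k]; first by rewrite [i]ord1.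
by case: (notF (ltn_ord k)).
Qed.

Lemma functor_arrows a (F F' : efunctor (L (arrows a)) X) :
  amap F (@edge_arrow (arrows a) ord0) = amap F' (@edge_arrow (arrows a) ord0) -> F = F'.
Proof.
move=> e; have e1 := congr1 (fun s => projT1 s) e.
apply: lin_functor_ext => [[[|[|m]] lt]|k] //; last by rewrite [k]ord1.
- have := congr1 fst e1; rewrite /= (_ : src ord0 = Ordinal lt) //.
  exact: val_inj.
- have := congr1 snd e1; rewrite /= (_ : tgt ord0 = Ordinal lt) //.
  exact: val_inj.
Qed.

Definition of_triangle a (x y z : X) (v : hom (E0 a) (ehom y z))
  (u : hom (E0 a) (ehom x y)) : efunctor (L (triangles a)) X.
Proof.
apply: (lin_ext K (G (triangles a)) (D := X) (fun i => nth z [:: x; y; z] i)).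
by case=> [[|[|m]] lt]; [exact: u | exact: v | have := notF lt].
Defined.

(** The edges of the two-edge tree meet in a vertex which is presented in two
ways, as a target and as a source; existential vertices hide this. *)
Lemma triangle_ex a (x y z : X) (v : hom (E0 a) (ehom y z))
    (u : hom (E0 a) (ehom x y)) :
  exists (p0 p1 p2 : L (triangles a)) (e1 : hom (E0 a) (ehom p1 p2))
    (e0 : hom (E0 a) (ehom p0 p1)) (W : efunctor (L (triangles a)) X),
    Arr v = amap W (Arr e1) /\ Arr u = amap W (Arr e0).
Proof.
pose k0 : 'I_2 := ord0; pose k1 : 'I_2 := ord_max.
have [e1 e1E] : exists e1 : hom (E0 a) (@ehom V (L (triangles a)) (tgt k0) (tgt k1)),
    Arr e1 = @edge_arrow (triangles a) k1.
  by have <- : src k1 = tgt k0 by [exact: val_inj]; exists (edge K (G (triangles a)) k1).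
exists (src k0), (tgt k0), (tgt k1), e1, (edge K (G (triangles a)) k0), (of_triangle v u).
by rewrite e1E /amap !lin_extE.
Qed.

End Cells.

Hypothesis E0dense : dense E0.

(** This is faithfulness of the nerve. *)
Lemma dense_ext (P Q : V) (f g : hom P Q) :
  (forall a (u : hom (E0 a) P), f ∘ u = g ∘ u) -> f = g.
Proof. by move=> e; apply: (bij_inj (E0dense P Q)); apply: psh_hom_eq. Qed.

Lemma nerve_inj (X Y : ecat V) (h h' : efunctor X Y) :
  (forall T (F : efunctor (L T) X), efunctor_comp h F = efunctor_comp h' F) -> h = h'.
Proof.
move=> e.
have e0 x : h x = h' x.
  by have := congr1 (fun F => efob F (ord0 : L vertices)) (e _ (of_vertex x)).
have e1 a (s : arrow X (E0 a)) : amap h s = amap h' s.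
  by rewrite -(of_arrow_edge s) -(amap_comp h) -(amap_comp h') e.
case: h h' e0 e1 {e} => [h h1 p q] [h' h1' p' q'] /= /functional_extensionality e.
subst h' => e; apply: efunctor_eq => x y; apply: dense_ext => a u.
exact: Arr_inj (e a (Arr u)).
Qed.

Section Surjective.
Variables (X Y : ecat V) (t : forall T, efunctor (L T) X -> efunctor (L T) Y).
Hypothesis t_nat : forall S T (F : efunctor (L T) X) (H : efunctor (L S) (L T)),
  t (efunctor_comp F H) = efunctor_comp (t F) H.

Definition nerve_ob (x : X) : Y := t (of_vertex x) (ord0 : L vertices).

Definition nerve_arrow a (s : arrow X (E0 a)) : arrow Y (E0 a) :=
  amap (t (of_arrow s)) (@edge_arrow (arrows a) ord0).

(** Naturality along the functor that represents the vertex [i]. *)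
Lemma nerve_ob_at T (F : efunctor (L T) X) (i : L T) : t F i = nerve_ob (F i).
Proof.
rewrite /nerve_ob.
have <- : efunctor_comp F (of_vertex i) = of_vertex (F i).
  exact: functor_vertices.
by rewrite t_nat.
Qed.

(** Naturality along the functor that represents the arrow [s].  With [F]
representing an arrow, an object or a composable pair, this gives naturality in
[a], preservation of identities and preservation of composition. *)
Lemma nerve_arrow_at T (F : efunctor (L T) X) a (s : arrow (L T) (E0 a)) :
  nerve_arrow (amap F s) = amap (t F) s.
Proof.
rewrite /nerve_arrow.
have <- : efunctor_comp F (of_arrow s) = of_arrow (amap F s).
  by apply: functor_arrows; rewrite amap_comp !of_arrow_edge.
by rewrite t_nat amap_comp of_arrow_edge.
Qed.

Lemma nerve_hom_ex x y a (u : hom (E0 a) (ehom x y)) :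
  exists v : hom (E0 a) (ehom (nerve_ob x) (nerve_ob y)), nerve_arrow (Arr u) = Arr v.
Proof.
have e : projT1 (nerve_arrow (Arr u)) = (nerve_ob x, nerve_ob y).
  by rewrite /nerve_arrow /= !nerve_ob_at.
case: (nerve_arrow _) e => p v /= e; subst p.
by exists v.
Qed.

Definition nerve_hom x y a (u : hom (E0 a) (ehom x y)) :=
  proj1_sig (constructive_indefinite_description _ (nerve_hom_ex u)).

Lemma nerve_homE x y a (u : hom (E0 a) (ehom x y)) :
  nerve_arrow (Arr u) = Arr (nerve_hom u).
Proof. exact: (proj2_sig (constructive_indefinite_description _ (nerve_hom_ex u))). Qed.

Lemma nerve_hom_nat x y a b (f : hom a b) (u : hom (E0 b) (ehom x y)) :
  nerve_hom (u ∘ fmap E0 f) = nerve_hom u ∘ fmap E0 f.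
Proof.
(* Precomposition with the image of [f] commutes with enriched functors. *)
pose sub C (s : arrow C (E0 b)) : arrow C (E0 a) := Arr (projT2 s ∘ fmap E0 f).
have sub_amap C D (F : efunctor C D) s : sub D (amap F s) = amap F (sub C s).
  by rewrite /sub /amap /= -compA.
apply: Arr_inj; rewrite -nerve_homE.
have -> : Arr (nerve_hom u ∘ fmap E0 f) = sub Y (Arr (nerve_hom u)) by [].
rewrite -nerve_homE [in RHS]/nerve_arrow sub_amap -nerve_arrow_at.
by rewrite -sub_amap of_arrow_edge.
Qed.

Lemma nerve_fmap_ex x y : exists h : hom (ehom x y) (ehom (nerve_ob x) (nerve_ob y)),
  forall a (u : hom (E0 a) (ehom x y)), h ∘ u = nerve_hom u.
Proof.
pose P := nerve E0 (ehom x y).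
pose Q := nerve E0 (ehom (nerve_ob x) (nerve_ob y)).
pose s : psh_hom P Q := @PshHom A P Q
  (fun a (u : hom (E0 a) (ehom x y)) => nerve_hom u) (fun a b f u => nerve_hom_nat f u).
have [g _ gK] := E0dense (ehom x y) (ehom (nerve_ob x) (nerve_ob y)).
by exists (g s) => a u; have := congr1 (fun r : psh_hom P Q => r a u) (gK s).
Qed.

Definition nerve_fmap x y :=
  proj1_sig (constructive_indefinite_description _ (nerve_fmap_ex x y)).

Lemma nerve_fmapE x y a (u : hom (E0 a) (ehom x y)) :
  Arr (nerve_fmap x y ∘ u) = nerve_arrow (Arr u).
Proof.
rewrite nerve_homE; congr Arr.
exact: (proj2_sig (constructive_indefinite_description _ (nerve_fmap_ex x y))).
Qed.

Definition nerve_functor : efunctor X Y.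
Proof.
exists nerve_ob nerve_fmap.
- move=> x; apply: dense_ext => a u; apply: Arr_inj.
  rewrite -compA nerve_fmapE.
  (* The identity of [x] is the image of an identity in the no-edge tree. *)
  have -> : Arr (eid x ∘ u) = amap (of_vertex x) (Arr (eid (ord0 : L vertices) ∘ u)).
    by rewrite /amap /= (efmap0 (of_vertex x)).
  by rewrite nerve_arrow_at /amap /= (efmap0 (t (of_vertex x))).
- move=> x y z; apply: dense_ext => a vu.
  rewrite -(pair_eta vu); move: (pr1 ∘ vu) (pr2 ∘ vu) => v u.
  (* The pair [v], [u] is the image of the two edges of the two-edge tree. *)
  have [p0 [p1 [p2 [e1 [e0 [W [Wv Wu]]]]]]] := triangle_ex v u.
  have F_comp D (F : efunctor (L (triangles a)) D) :
      amap F (Arr (e1 ⊙ e0)) = Arr ((efmap F ∘ e1) ⊙ (efmap F ∘ e0)).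
    by rewrite /amap /= (efmap2 F).
  have vu_W : Arr (v ⊙ u) = amap W (Arr (e1 ⊙ e0)).
    by rewrite F_comp; apply: Arr_comp_eq.
  rewrite !cartE; apply: Arr_inj; rewrite nerve_fmapE vu_W nerve_arrow_at F_comp.
  by apply: Arr_comp_eq; rewrite nerve_fmapE ?Wv ?Wu nerve_arrow_at.
Defined.

Lemma nerve_functorP T (F : efunctor (L T) X) : efunctor_comp nerve_functor F = t F.
Proof.
apply: lin_functor_ext => [i|k]; first by rewrite nerve_ob_at.
rewrite /= -compA nerve_fmapE.
exact: (nerve_arrow_at F (edge_arrow k)).
Qed.

End Surjective.

Hypothesis E0ff : fully_faithful E0.
Hypothesis E0ne : forall a, hom (E0 a) (zero K) -> False.

Lemma wreath_embedding_dense : dense (wreath_embedding K G).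
Proof.
set E := wreath_embedding K G; move=> X Y; apply: inj_surj_bij => [h h' e|t].
  apply: nerve_inj => T F.
  exact: (congr1 (fun s : psh_hom (nerve E X) (nerve E Y) => @pshfun _ _ _ s T F) e).
pose t' T (F : efunctor (L T) X) : efunctor (L T) Y := @pshfun _ _ _ t T F.
have t'_nat S T (F : efunctor (L T) X) (H : efunctor (L S) (L T)) :
    t' S (efunctor_comp F H) = efunctor_comp (t' T F) H.
  by have [f <-] := wreath_map_surj E0ff E0ne H; exact: (@psh_nat _ _ _ t _ _ f F).
exists (nerve_functor t'_nat); apply: psh_hom_eq => T F.
exact: nerve_functorP.
Qed.

End Density.

(** * Isomorphic level-trees are equal *)

(** Being injective, [f] is strictly increasing. *)
Lemma mono_section_le m l (f : mono m l) (g : mono l m) : cancel f g ->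
  forall i : 'I_m.+1, i <= f i.
Proof.
move=> fK [i im]; elim: i im => [//|i IH] im.
have im' : i < m.+1 := ltnW im.
apply: leq_ltn_trans (IH im') _.
rewrite ltn_neqAle mono_le ?leqnSn // andbT.
by apply/eqP => /val_inj /(can_inj fK) /(congr1 val) /= /n_Sn.
Qed.

Lemma mono_iso_id m (f g : mono m m) : cancel f g -> cancel g f -> f =1 id.
Proof.
move=> fK gK i; apply/val_inj/eqP; rewrite eqn_leq (mono_section_le fK) andbT.
by have := mono_section_le gK (f i); rewrite fK.
Qed.

Lemma mono_iso_len m l (f : mono m l) (g : mono l m) : cancel f g -> cancel g f -> m = l.
Proof.
have le m' l' (h : mono m' l') (h' : mono l' m') : cancel h h' -> m' <= l'.
  move=> hK; have := mono_section_le hK ord_max => /= h1.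
  by rewrite -ltnS (leq_ltn_trans h1) ?ltn_ord.
by move=> fK gK; apply/eqP; rewrite eqn_leq (le _ _ f g) // (le _ _ g f).
Qed.

Lemma wcpt_eq (A : category) (S T : tuples A) (f g : wreath_hom S T) i k
  (hf : over (wmap f) i k) (hg : over (wmap g) i k) : f = g -> wcpt hf = wcpt hg.
Proof. by move=> e; subst g; congr wcpt; exact: bool_irrelevance. Qed.

(** The maps of ordinals are identities, so that each entry of one tuple is
compared with the entry of the other tuple at the same place. *)
Lemma wreath_skeletal (A : category) : skeletal A -> skeletal (wreath A).
Proof.
move=> skA [m s] [l t] f g gf fg.
have wfK : cancel (wmap f) (wmap g).
  by move=> i; exact: (congr1 (fun h : wreath_hom (Tuple s) (Tuple s) => wmap h i) gf).
have wgK : cancel (wmap g) (wmap f).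
  by move=> i; exact: (congr1 (fun h : wreath_hom (Tuple t) (Tuple t) => wmap h i) fg).
have ml := mono_iso_len wfK wgK; rewrite /= in ml; subst l.
have over_f i : over (wmap f) i i.
  by rewrite /over !(mono_iso_id wfK wgK) /= /bump /= add1n leqnn ltnSn.
have over_g i : over (wmap g) i i.
  by rewrite /over !(mono_iso_id wgK wfK) /= /bump /= add1n leqnn ltnSn.
congr Tuple; apply: functional_extensionality => i.
apply: (skA _ _ (wcpt (over_f i)) (wcpt (over_g i))).
- rewrite -(wreath_compE _ _ (over_comp (over_f i) (over_g i))).
  exact: etrans (@wcpt_eq A _ _ _ (wreath_id (Tuple s)) i i _ (over_idm i) gf) (wreath_idE _).
- rewrite -(wreath_compE _ _ (over_comp (over_g i) (over_f i))).
  exact: etrans (@wcpt_eq A _ _ _ (wreath_id (Tuple t)) i i _ (over_idm i) fg) (wreath_idE _).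
Qed.

Lemma Theta_skeletal n : skeletal (Theta n).
Proof. by elim: n => [[] []|n /wreath_skeletal]. Qed.

Lemma ff_skeletal_inj (C D : category) (F : functor C D) :
  fully_faithful F -> skeletal C -> injective (fob F).
Proof.
move=> Fff skC x y e.
have [f0 _ f0K] := Fff x y; have [g0 _ g0K] := Fff y x.
apply: (skC _ _ (f0 (cast e)) (g0 (cast (esym e)))).
- by apply: (bij_inj (Fff x x)); rewrite fmapM f0K g0K castK fmap1.
- by apply: (bij_inj (Fff y y)); rewrite fmapM f0K g0K castVK fmap1.
Qed.

(** * The embedding of the iterated wreath product *)

Lemma void_strict : @strict_initial Sets void.
Proof.
split=> [X|W X u f g]; first exact: of_void X.
by apply: functional_extensionality => w; case: (u w).
Qed.

Lemma ecat_void_strict (V : cartcat) (O : ecat V) :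
  (O -> void) -> @strict_initial (Cat_enriched V) O.
Proof.
move=> no; split=> [D|C D u f g].
  by exists (fun x => of_void D (no x)) (fun x y => of_void _ (no x)) => x; case: (no x).
by apply: efunctor_ext => x; case: (no (efob u x)).
Qed.

(** In positive dimension the free category on the empty graph has no objects. *)
Lemma free_empty n : strict_initial (free n (empty_graph n)).
Proof. by case: n => [|n]; [exact: void_strict | exact: ecat_void_strict]. Qed.

Section StarGraph.
Variables (m : nat) (E0 : functor (Theta m) (nCat m)).
Hypothesis E0E : forall S, E0 S = free m (star S).

Definition star_graph (T : tuples (Theta m)) : linear_graph (fun k => E0 (T k)).
Proof.
exists (fun i j => free m (@ghom _ (@star m.+1 T) i j)) => [k|i j no] /=.
  by rewrite valK eqxx E0E.
case: insubP => [k _ ki|_]; last exact: free_empty.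
case: eqP => [jk|_]; last exact: free_empty.
by case: (no k); apply: val_inj.
Defined.

Lemma wreath_star (T : Theta m.+1) :
  wreath_embedding (nCat_coprods m) star_graph T = free m.+1 (star T).
Proof. exact: (linE (nCat_coprods m) (star_graph T)). Qed.

End StarGraph.

Definition point_embedding : functor one_cat Sets.
Proof. by exists (fun _ => unit) (fun _ _ _ => id). Defined.

Lemma point_ff : fully_faithful point_embedding.
Proof.
move=> x y; exists (fun _ => tt) => [[]|f] //.
by apply: functional_extensionality => -[]; case: (f tt).
Qed.

Lemma point_dense : dense point_embedding.
Proof.
move=> X Y.
pose N := nerve point_embedding.
exists (fun (t : psh_hom (N X) (N Y)) (x : X) => t tt (fun _ => x) tt) => [h|t] //.
apply: psh_hom_eq => -[] u; apply: functional_extensionality => -[] /=.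
by congr (@pshfun one_cat _ _ t tt _ tt); apply: functional_extensionality => -[].
Qed.

(** The last clause, needed for the induction, is what forces functors between
free linear categories to be monotone on vertices. *)
Lemma Theta_embedding n : exists E : functor (Theta n) (nCat n),
  [/\ forall T, E T = free n (star T),
      fully_faithful E, dense E
    & forall T, hom (E T) (free n (empty_graph n)) -> False].
Proof.
elim: n => [|m [E0 [E0E E0ff E0dense E0ne]]].
  exists point_embedding; split=> //; [exact: point_ff|exact: point_dense|].
  by move=> T /(_ tt).
have E0zero a : hom (E0 a) (zero (nCat_coprods m)) -> False.
  by move=> u; apply: (E0ne a); exact: (from_initial (zero_strict _) _ ∘ u).
exists (wreath_embedding (nCat_coprods m) (star_graph E0E)); split.
- exact: wreath_star.
- exact: wreath_embedding_ff.
- exact: wreath_embedding_dense.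
by move=> T F; case: (efob F ord0).
Qed.

Theorem theorem3p7 (n : nat) (n_gt0 : 0 < n) :
  exists E : functor (Theta n) (nCat n),
    [/\ forall T : Theta n, E T = free n (star T),
        injective (fob E),
        fully_faithful E
      & dense E].
Proof.
have [E [Estar Eff Edense _]] := Theta_embedding n.
by exists E; split=> //; exact: ff_skeletal_inj Eff (@Theta_skeletal n).
Qed.
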